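(* The frozen boundary curve $\partial\mathcal{D}$ can be parametrized as $$\chi(\omega)=\omega+\frac{\Pi(\omega)-1}{\Sigma(\omega)},\qquad \eta(\omega)=\frac{\Pi(\omega)\big(\Sigma(\omega)-\Pi(\omega)+2\big)-1}{\Pi(\omega)\Sigma(\omega)},$$ where $$\Pi(\omega)=\prod_{i=1}^k\frac{\omega-b_i}{\omega-a_i},\qquad \Sigma(\omega)=\sum_{i=1}^k\Big(\frac1{\omega-b_i}-\frac1{\omega-a_i}\Big),$$ with parameter $-\infty\le\omega<\infty$. As $\omega$ increases, the frozen boundary is passed in the clockwise direction (so that $\mathcal{D}$ is to the right of $\partial\mathcal{D}$).
   Context: Fix $k\ge2$ and reals $a_1<b_1<\dots<a_k<b_k$ with $\sum_i(b_i-a_i)=1$. The limiting polygon $\mathcal{P}$ in the $(\chi,\eta)$ plane ($\chi$ horizontal, $\eta$ vertical) has interior $\{(\chi,\eta):0<\eta<1,\ a_1+1-\eta<\chi<b_k,\ \text{and for no } i:\ a_i+1-\eta\le\chi\le b_i\}$. The liquid region $\mathcal{D}$ is the (open) set of $(\chi,\eta)$ inside $\mathcal{P}$ for which the equation $(w-\chi)\prod_{i=1}^k(w-a_i)=(w-\chi+1-\eta)\prod_{i=1}^k(w-b_i)$ has a pair of nonreal (complex conjugate) solutions; equivalently, the complex slope of the local limit of uniformly random lozenge tilings has positive imaginary part there. The frozen boundary $\partial\mathcal{D}$ is the curve bounding $\mathcal{D}$; on it the two complex conjugate solutions merge into a real double solution $w=\omega$, which serves as the parameter. The values of $\chi(\omega),\eta(\omega)$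 at $\omega=-\infty,a_i,b_i$ are understood as limits. *)

(* Defs.v *)
From HB Require Import structures.
From mathcomp Require Import all_boot all_order all_algebra.
From mathcomp Require Import all_classical all_reals all_analysis.
From mathcomp Require Import complex.

Set Implicit Arguments.
Unset Strict Implicit.
Unset Printing Implicit Defensive.

Import Order.TTheory GRing.Theory Num.Theory.
Import numFieldNormedType.Exports.

Local Open Scope classical_set_scope.
Local Open Scope ring_scope.

(* The plane is R * R, a point being (chi, eta) with chi horizontal and eta
   vertical.  The k >= 2 intervals [a_i, b_i] are indexed by 'I_m.+2, so that
   k = m.+2, a_1 = a ord0 and b_k = b ord_max. *)

Definition interlacing (R : realType) (m : nat) (a b : 'I_m.+2 -> R) : Prop :=
  (forall i, a i < b i) /\ (forall i j : 'I_m.+2, (i < j)%N -> b i < a j).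

Definition polygon_interior (R : realType) (m : nat) (a b : 'I_m.+2 -> R) :
    set (R * R) :=
  [set p | let: (chi, eta) := p in
    [/\ 0 < eta < 1,
        a ord0 + 1 - eta < chi < b ord_max &
        ~ exists i, a i + 1 - eta <= chi <= b i]].

Definition slope_equation (F : comNzRingType) (m : nat) (a b : 'I_m.+2 -> F)
    (chi eta w : F) : Prop :=
  (w - chi) * \prod_i (w - a i) = (w - chi + 1 - eta) * \prod_i (w - b i).

(* Left-hand side minus right-hand side of slope_equation; its multiple roots
   are the double solutions of the equation. *)
Definition slope_poly (R : realType) (m : nat) (a b : 'I_m.+2 -> R)
    (chi eta : R) : {poly R} :=
  ('X - chi%:P) * \prod_i ('X - (a i)%:P)
  - ('X - chi%:P + 1 - eta%:P) * \prod_i ('X - (b i)%:P).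

Definition liquid_region (R : realType) (m : nat) (a b : 'I_m.+2 -> R) :
    set (R * R) :=
  [set p | polygon_interior a b p /\
    exists w : R[i], [/\ complex.Im w != 0,
      slope_equation (real_complex R \o a) (real_complex R \o b)
        (real_complex R p.1) (real_complex R p.2) w &
      slope_equation (real_complex R \o a) (real_complex R \o b)
        (real_complex R p.1) (real_complex R p.2) (conjc w)]].

Definition frontier (T : topologicalType) (A : set T) : set T :=
  closure A `\` A°.

Definition PiF (R : realType) (m : nat) (a b : 'I_m.+2 -> R) (w : R) : R :=
  \prod_i ((w - b i) / (w - a i)).

Definition SigmaF (R : realType) (m : nat) (a b : 'I_m.+2 -> R) (w : R) : R :=
  \sum_i ((w - b i)^-1 - (w - a i)^-1).

Definition chiF (R : realType) (m : nat) (a b : 'I_m.+2 -> R) (w : R) : R :=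
  w + (PiF a b w - 1) / SigmaF a b w.

Definition etaF (R : realType) (m : nat) (a b : 'I_m.+2 -> R) (w : R) : R :=
  (PiF a b w * (SigmaF a b w - PiF a b w + 2) - 1)
    / (PiF a b w * SigmaF a b w).

(* At w = a_i and w = b_i the formulas above divide by zero, and only their
   limits are meaningful.  The value at +oo is not a parameter value of its
   own; it is used to say that the curve closes up. *)
Definition frozen_curve (R : realType) (m : nat) (a b : 'I_m.+2 -> R)
    (x : \bar R) : R * R :=
  match x with
  | EFin w => if [exists i, (w == a i) || (w == b i)]
              then (lim (chiF a b t @[t --> w^']), lim (etaF a b t @[t --> w^']))
              else (chiF a b w, etaF a b w)
  | +oo%E => (lim (chiF a b t @[t --> +oo]), lim (etaF a b t @[t --> +oo]))
  | -oo%E => (lim (chiF a b t @[t --> -oo]), lim (etaF a b t @[t --> -oo]))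
  end.

(* theta is a continuous determination of the angle of the vector from p to
   g x; for a closed curve g this says that its winding number around p is
   -1. *)
Definition winds_once_clockwise (R : realType) (g : \bar R -> R * R)
    (p : R * R) : Prop :=
  exists theta : \bar R -> R,
    [/\ continuous theta,
        forall x, exists2 r : R, 0 < r &
          g x = p + (r * cos (theta x), r * sin (theta x)) &
        theta +oo%E - theta -oo%E = - (2 * pi)].

(* (T.2, - T.1) is the velocity T turned clockwise by a right angle, i.e. the
   right-hand normal; the velocity vanishes exactly at the cusps. *)
Definition lies_right_of (R : realType) (D : set (R * R))
    (g : \bar R -> R * R) : Prop :=
  forall (w : R) (T : R * R),
    is_derive w (1 : R) (fun t : R => g t%:E) T -> T != 0 ->
    \forall s \near (0 : R)^'+,
      D (g w%:E + s *: (T.2, - T.1)) /\ ~ D (g w%:E - s *: (T.2, - T.1)).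

(* Main.v *)
(* Put v = chi + eta - 1 and let C = prod (w - a_i) - prod (w - b_i), a polynomial
   of degree k - 1.  Interlacing makes all residues c_i of C at the nodes a_i
   (and those at the b_i) positive, with sum 1, and the slope equation reads
   (w - v) sum_i c_i / (w - a_i) = 1 - eta.  For w in the upper half-plane this
   is two real equations in (v, eta), with a unique solution: v is the mean of
   the a_i for the weights c_i / |w - a_i|^2.  The resulting map is real-algebraic
   up to the projective real line; there it is the frozen curve, inside it is the
   liquid region.

   Injectivity on the boundary and disjointness from the interior come from one
   residue computation: the slope polynomial has no divisor of degree 4 that is
   nonnegative at all nodes.  The frontier is then found by compactness of the
   closed half-plane.  Near the curve the region lies to the right because, on
   the right, a real-rooted slope polynomial would violate Laguerre's inequality,
   and, on the left, it acquires two more real roots.  For the winding number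
   around the point with root z0, the vector from that point to the curve is, up
   to a linear map reversing orientation, (z0 - w)^2 times factors staying in a
   half-plane. *)
Require Import Defs.
From HB Require Import structures.
From mathcomp Require Import all_boot all_order all_algebra.
From mathcomp Require Import all_classical all_reals all_analysis.
From mathcomp Require Import complex zify ring lra.
Import Order.TTheory GRing.Theory Num.Theory.
Import numFieldNormedType.Exports.
Local Open Scope classical_set_scope.
Local Open Scope ring_scope.

Set Implicit Arguments.
Unset Strict Implicit.
Unset Printing Implicit Defensive.

(** * Lagrange interpolation and the key identity *)

(** At the nodes and at infinity the formulas for chi and eta degenerate, and computing each limit
    separately would be painful. Multiplying the weights c_i / |z - a_i|^2 by the product of all |z
    - a_j|^2 and homogenizing z removes the singular cases: abscissa and height become quotients of
    polynomials whose denominator is positive on the whole closed half-plane, so continuity is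
    immediate and every limit is a value.

    [key_identity] gives in closed form the quotient of the slope polynomial by the quadratic with
    the prescribed roots. Because this cofactor is explicit and continuous in the root, both the
    tangent and the winding number can be read off from it.

    Openness of the liquid region rests on a quantitative fact: a polynomial with only real roots
    cannot be small at a non-real point unless its leading coefficient is small. Both node families
    are carried along because a curve parameter may itself be a node, and then only the other family
    has no node near it. *)

Definition nodal (R : nzRingType) n (a : 'I_n -> R) : {poly R} :=
  \prod_i ('X - (a i)%:P).
Definition nodal1 (R : nzRingType) n (a : 'I_n -> R) i : {poly R} :=
  \prod_(j | j != i) ('X - (a j)%:P).
Definition nodal2 (R : nzRingType) n (a : 'I_n -> R) i j : {poly R} :=
  \prod_(l | (l != i) && (l != j)) ('X - (a l)%:P).
Definition residue (R : fieldType) n (a : 'I_n -> R) (P : {poly R}) i : R :=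
  P.[a i] / (nodal1 a i).[a i].

Section Interpolation.
Variables (R : fieldType) (n : nat) (a : 'I_n -> R).
Hypothesis a_inj : injective a.

Lemma nodalE i : nodal a = ('X - (a i)%:P) * nodal1 a i.
Proof. by rewrite /nodal (bigD1 i). Qed.

Lemma nodal1E i j : i != j -> nodal1 a i = ('X - (a j)%:P) * nodal2 a i j.
Proof. by move=> ij; rewrite /nodal1 (bigD1 j) // eq_sym. Qed.

Lemma nodal2C i j : nodal2 a i j = nodal2 a j i.
Proof. by apply: eq_bigl => l; rewrite andbC. Qed.

Lemma nodal_monic : nodal a \is monic.
Proof. exact: monic_prod_XsubC. Qed.

Lemma nodal1_monic i : nodal1 a i \is monic.
Proof. by apply: monic_prod => j _; rewrite monicXsubC. Qed.

Lemma size_nodal : size (nodal a) = n.+1.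
Proof. by rewrite size_prod_XsubC /index_enum -enumT size_enum_ord. Qed.

Lemma size_nodal1 i : size (nodal1 a i) = n.
Proof.
have := size_nodal; rewrite (nodalE i) size_monicM ?monicXsubC //.
  by rewrite size_XsubC add2n /= => -[].
exact/monic_neq0/nodal1_monic.
Qed.

Lemma nodal1_eval i j : (nodal1 a i).[a j] != 0 -> i = j.
Proof.
apply: contraNeq => ij; rewrite (nodal1E ij).
by rewrite !hornerE subrr mul0r.
Qed.

Lemma nodal1_neq0 i : (nodal1 a i).[a i] != 0.
Proof.
rewrite /nodal1 horner_prod; apply/prodf_neq0 => j ji.
by rewrite !hornerE subr_eq0 (inj_eq a_inj) eq_sym.
Qed.

Lemma interpolation (P : {poly R}) : (size P <= n)%N ->
  P = \sum_i residue a P i *: nodal1 a i.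
Proof.
move=> sP; apply/eqP; rewrite -subr_eq0; apply/eqP.
set D := _ - _.
have sD : (size D <= n)%N.
  rewrite /D (leq_trans (size_polyD _ _)) // geq_max sP size_polyN.
  apply: (leq_trans (size_sum _ _ _)); apply/bigmax_leqP => i _.
  by apply: (leq_trans (size_scale_leq _ _)); rewrite size_nodal1.
apply: (@roots_geq_poly_eq0 _ _ [seq a i | i <- enum 'I_n]).
- apply/allP => _ /mapP[i _ ->]; rewrite rootE /D !hornerE horner_sum.
  rewrite (bigD1 i) //= big1 ?addr0 => [|j ji].
    by rewrite !hornerE /residue divfK ?subrr // nodal1_neq0.
  rewrite hornerZ; have [->|/nodal1_eval eji] := eqVneq (nodal1 a j).[a i] 0.
    by rewrite mulr0.
  by rewrite eji eqxx in ji.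
- by rewrite map_inj_uniq // enum_uniq.
- by rewrite size_map size_enum_ord.
Qed.

(** Each [nodal1] is monic of degree n - 1, so the coefficient of that degree in the interpolation
    formula is the bare sum of residues. *)
Lemma sum_residue (P : {poly R}) : (size P <= n)%N ->
  \sum_i residue a P i = P`_n.-1.
Proof.
move=> sP; rewrite [in RHS](interpolation sP) coef_sum.
apply: eq_bigr => i _; rewrite coefZ.
have := nodal1_monic i; rewrite monicE lead_coefE size_nodal1 => /eqP ->.
by rewrite mulr1.
Qed.

Lemma sum_residue0 (P : {poly R}) : (size P < n)%N ->
  \sum_i residue a P i = 0.
Proof.
move=> sP; rewrite sum_residue ?(ltnW sP) // nth_default //.
by case: n sP.
Qed.

End Interpolation.

Lemma nodal_sub_size (R : fieldType) n (a b : 'I_n -> R) :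
  (size (nodal a - nodal b)%R <= n)%N.
Proof.
have s : (size (nodal a - nodal b)%R <= n.+1)%N.
  rewrite (leq_trans (size_polyD _ _)) // geq_max size_polyN !size_nodal.
  by rewrite leqnn.
move: s; rewrite leq_eqVlt => /orP[/eqP s|]; last by rewrite ltnS.
have := lead_coef_eq0 (nodal a - nodal b).
rewrite lead_coefE s /= coefB.
have := nodal_monic a; have := nodal_monic b; rewrite !monicE !lead_coefE.
rewrite !size_nodal /= => /eqP -> /eqP ->; rewrite subrr eqxx => /esym/eqP e.
by move: s; rewrite e size_poly0.
Qed.

(** With [sum_residue], this turns the normalization of the total length into weights of sum 1. *)
Lemma nodal_sub_coef (R : fieldType) n (a b : 'I_n.+1 -> R) :
  (nodal a - nodal b)`_n = \sum_i (b i - a i).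
Proof.
rewrite coefB /nodal.
have c (f : 'I_n.+1 -> R) : (\prod_i ('X - (f i)%:P))`_n = - \sum_i f i.
  have e : \prod_i ('X - (f i)%:P) = \prod_(x <- [seq f i | i <- enum 'I_n.+1]) ('X - x%:P).
    by rewrite big_map big_enum.
  have s : size [seq f i | i <- enum 'I_n.+1] = n.+1 by rewrite size_map size_enum_ord.
  have := @coefPn_prod_XsubC _ [seq f i | i <- enum 'I_n.+1].
  by rewrite e s => ->; rewrite ?big_map ?big_enum.
by rewrite !c sumrB opprK addrC.
Qed.

Section KeyIdentity.
(* [x + i y : q] are homogeneous coordinates of a point of the closed upper
   half-plane, infinity included. *)
Variables (K : comNzRingType) (n : nat) (a c : 'I_n -> K).

Definition sqdist (x y q : K) j := (x - a j * q) ^+ 2 + y ^+ 2.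
Definition wprod1 (x y q : K) i := \prod_(j | j != i) sqdist x y q j.
Definition wprod2 (x y q : K) i j :=
  \prod_(l | (l != i) && (l != j)) sqdist x y q l.
(** Up to the common factor prod_j |z - a_j q|^2, these are the sums of c_i / |z - a_i q|^2 and of
    c_i a_i / |z - a_i q|^2. Cleared of denominators, they stay meaningful when z is itself a
    node. *)
Definition mass x y q := \sum_i c i * wprod1 x y q i.
Definition moment x y q := \sum_i c i * a i * wprod1 x y q i.
(** A variance written over pairs of nodes, whence the factor 2 in [curve_height]. The terms with i
    = j, where [wprod2] omits only one factor, vanish; q^2 brings the degree up to that of
    [mass]. *)
Definition spread x y q := q ^+ 2 *
  \sum_i \sum_j c i * c j * (a i - a j) ^+ 2 * wprod2 x y q i j.

Lemma wprod1E x y q i j : i != j ->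
  wprod1 x y q i = sqdist x y q j * wprod2 x y q i j.
Proof. by move=> ij; rewrite /wprod1 (bigD1 j) // eq_sym. Qed.

Lemma wprod2C x y q i j : wprod2 x y q i j = wprod2 x y q j i.
Proof. by apply: eq_bigl => l; rewrite andbC. Qed.

Lemma sqdist_scale l x y q j :
  sqdist (l * x) (l * y) (l * q) j = l ^+ 2 * sqdist x y q j.
Proof. by rewrite /sqdist; ring. Qed.

Lemma wprod1_scale l x y q i : wprod1 (l * x) (l * y) (l * q) i =
  (\prod_(j < n | j != i) l ^+ 2) * wprod1 x y q i.
Proof. by rewrite /wprod1 -big_split; apply: eq_bigr => j _; exact: sqdist_scale. Qed.

Lemma wprod2_scale l x y q i j : wprod2 (l * x) (l * y) (l * q) i j =
  (\prod_(k < n | (k != i) && (k != j)) l ^+ 2) * wprod2 x y q i j.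
Proof. by rewrite /wprod2 -big_split; apply: eq_bigr => k _; exact: sqdist_scale. Qed.

(* Symmetrizing the double sum, each pair {i, j} contributes (a i - a j)^2. *)
Lemma key_identity x y q (X : K) (A : K) (A1 : 'I_n -> K) (A2 : 'I_n -> 'I_n -> K) :
  \sum_i c i = 1 ->
  (forall i, A = (X - a i) * A1 i) ->
  (forall i j, i != j -> A1 i = (X - a j) * A2 i j) ->
  (forall i j, A2 i j = A2 j i) ->
  2 * ((X * mass x y q - moment x y q) * (\sum_i c i * A1 i)
       - mass x y q * A) + spread x y q * A
  = (q ^+ 2 * X ^+ 2 - 2 * x * q * X + x ^+ 2 + y ^+ 2) *
    \sum_i \sum_j c i * c j * (a i - a j) ^+ 2 * wprod2 x y q i j * A2 i j.
Proof.
move=> c1 hA hA1 hA2.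
have e1 : (X * mass x y q - moment x y q) * (\sum_i c i * A1 i) =
    \sum_i \sum_j c i * c j * (X - a j) * wprod1 x y q j * A1 i.
  rewrite exchange_big /= /mass /moment mulr_sumr -sumrB mulr_suml.
  apply: eq_bigr => j _; rewrite mulr_sumr; apply: eq_bigr => i _; ring.
have e2 : mass x y q * A = \sum_i \sum_j c i * c j * wprod1 x y q j * A.
  rewrite -[LHS]mul1r -c1 mulr_suml; apply: eq_bigr => i _.
  rewrite /mass mulr_suml mulr_sumr; apply: eq_bigr => j _; ring.
pose F i j := c i * c j * ((X - a j) * wprod1 x y q j * A1 i - wprod1 x y q j * A).
have e3 : 2 * ((X * mass x y q - moment x y q) * (\sum_i c i * A1 i) - mass x y q * A)
   = \sum_i \sum_j (F i j + F j i).
  have -> : \sum_i \sum_j (F i j + F j i) = \sum_i \sum_j F i j + \sum_i \sum_j F i j.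
    rewrite [X in _ = _ + X]exchange_big -big_split /=.
    by apply: eq_bigr => i _; rewrite big_split.
  rewrite -[RHS]mulr2n -[RHS]mulr_natl; congr (_ * _).
  rewrite e1 e2 -sumrB; apply: eq_bigr => i _; rewrite -sumrB.
  by apply: eq_bigr => j _; rewrite /F; ring.
rewrite e3 /spread [q ^+ 2 * _ * A]mulrAC !mulr_sumr -big_split; apply: eq_bigr => i _.
rewrite !mulr_sumr -big_split; apply: eq_bigr => j _ /=.
have [<-|ij] := eqVneq i j; first by rewrite /F (hA i); ring.
have ji : j != i by rewrite eq_sym.
(* Let N(X) be the quadratic on the right, so that N(a_i) is the [sqdist] of i. After removal of
   common factors, what remains is its interpolation at a_i and a_j: (a_i - a_j) N(X) = (X - a_j)
   N(a_i) - (X - a_i) N(a_j) + q^2 (a_i - a_j) (X - a_i) (X - a_j). *)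
rewrite /F (hA i) (hA1 _ _ ij) (hA1 _ _ ji) (wprod1E _ _ _ ij) (wprod1E _ _ _ ji).
rewrite (hA2 j i) (wprod2C _ _ _ j i) /sqdist; ring.
Qed.

End KeyIdentity.

(** * Residues of interlacing nodes and partial fractions *)

Definition interlaced (R : realType) n (a b : 'I_n -> R) : Prop :=
  (forall i, a i < b i) /\ (forall i j : 'I_n, (i < j)%N -> b i < a j).

Section Weights.
Variables (R : realType) (n : nat) (a b : 'I_n -> R).
Hypothesis hab : interlaced a b.

Lemma ltn_ord_case (i j : 'I_n) : i != j -> (i < j)%N \/ (j < i)%N.
Proof. by rewrite -val_eqE /= neq_ltn => /orP. Qed.

Lemma interlaced_mono_a (i j : 'I_n) : (i < j)%N -> a i < a j.
Proof. by case: hab => h1 h2 ij; rewrite (lt_trans (h1 i)) ?h2. Qed.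

Lemma interlaced_mono_b (i j : 'I_n) : (i < j)%N -> b i < b j.
Proof. by case: hab => h1 h2 ij; rewrite (lt_trans _ (h1 j)) ?h2. Qed.

Lemma interlaced_inj_a : injective a.
Proof.
move=> i j e; apply/eqP/negPn/negP => /ltn_ord_case[] /interlaced_mono_a;
by rewrite e ltxx.
Qed.

Lemma interlaced_inj_b : injective b.
Proof.
move=> i j e; apply/eqP/negPn/negP => /ltn_ord_case[] /interlaced_mono_b;
by rewrite e ltxx.
Qed.

(** By interlacing, b_j lies on the same side of a_i as a_j for every j != i, so each factor (a_i -
    b_j) / (a_i - a_j) is positive. *)
Lemma residue_a_gt0 i : 0 < residue a (nodal a - nodal b) i.
Proof.
case: (hab) => h1 h2.
have -> : residue a (nodal a - nodal b) i =
    (b i - a i) * \prod_(j | j != i) ((a i - b j) / (a i - a j)).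
  rewrite /residue (nodalE a i) (nodalE b i) /nodal1 !hornerE !horner_prod.
  rewrite subrr mul0r sub0r -mulNr opprB -mulrA -prodf_div; congr (_ * _).
  by apply: eq_bigr => j _; rewrite !hornerE.
rewrite mulr_gt0 ?subr_gt0 //; apply: prodr_gt0 => j /ltn_ord_case[ji|ij].
  by rewrite divr_gt0 ?subr_gt0 ?h2 ?interlaced_mono_a.
rewrite -mulrNN -invrN !opprB divr_gt0 ?subr_gt0 ?interlaced_mono_a //.
by rewrite (lt_trans (h1 i)) ?interlaced_mono_b.
Qed.

Lemma residue_b_gt0 i : 0 < residue b (nodal a - nodal b) i.
Proof.
case: (hab) => h1 h2.
have -> : residue b (nodal a - nodal b) i =
    (b i - a i) * \prod_(j | j != i) ((b i - a j) / (b i - b j)).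
  rewrite /residue (nodalE a i) (nodalE b i) /nodal1 !hornerE !horner_prod.
  rewrite subrr mul0r subr0 -mulrA -prodf_div; congr (_ * _).
  by apply: eq_bigr => j _; rewrite !hornerE.
rewrite mulr_gt0 ?subr_gt0 //; apply: prodr_gt0 => j /ltn_ord_case[ji|ij].
  rewrite divr_gt0 ?subr_gt0 ?interlaced_mono_b //.
  by rewrite (lt_trans (h1 j)) ?interlaced_mono_b.
by rewrite -mulrNN -invrN !opprB divr_gt0 ?subr_gt0 ?interlaced_mono_b ?h2.
Qed.

End Weights.

(** * Real polynomials at non-real points *)

Section UpperHalfPlane.
Variable R : realType.
Implicit Types (P S : {poly R}) (z : R[i]).

Definition evalC P z : R[i] := (map_poly (real_complex R) P).[z].

Lemma evalCD P S z : evalC (P + S) z = evalC P z + evalC S z.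
Proof. by rewrite /evalC rmorphD hornerD. Qed.
Lemma evalCN P z : evalC (- P) z = - evalC P z.
Proof. by rewrite /evalC rmorphN hornerN. Qed.
Lemma evalCB P S z : evalC (P - S) z = evalC P z - evalC S z.
Proof. by rewrite evalCD evalCN. Qed.
Lemma evalCM P S z : evalC (P * S) z = evalC P z * evalC S z.
Proof. by rewrite /evalC rmorphM hornerM. Qed.
Lemma evalCC (r : R) z : evalC r%:P z = r%:C%C.
Proof. by rewrite /evalC map_polyC hornerC. Qed.
Lemma evalC1 z : evalC 1 z = 1.
Proof. by rewrite -polyC1 evalCC. Qed.
Lemma evalCX z : evalC 'X z = z.
Proof. by rewrite /evalC map_polyX hornerX. Qed.
Lemma evalCZ (r : R) P z : evalC (r *: P) z = r%:C%C * evalC P z.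
Proof. by rewrite -mul_polyC evalCM evalCC. Qed.
Lemma evalC_sum (I : finType) (p : pred I) (F : I -> {poly R}) z :
  evalC (\sum_(i | p i) F i) z = \sum_(i | p i) evalC (F i) z.
Proof. by rewrite /evalC rmorph_sum horner_sum. Qed.
Lemma evalC_prod (I : finType) (p : pred I) (F : I -> {poly R}) z :
  evalC (\prod_(i | p i) F i) z = \prod_(i | p i) evalC (F i) z.
Proof. by rewrite /evalC rmorph_prod horner_prod. Qed.
Lemma evalC_conj P z : evalC P (conjc z) = conjc (evalC P z).
Proof.
rewrite /evalC -horner_map -map_poly_comp /=.
by rewrite (eq_map_poly (g := real_complex R)) // => r; exact: conjc_real.
Qed.

Definition evalCE := (evalCD, evalCN, evalCM, evalCC, evalCX).

Lemma ImD (z z' : R[i]) : complex.Im (z + z') = complex.Im z + complex.Im z'.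
Proof. by case: z => ? ?; case: z'. Qed.

Lemma ImN (z : R[i]) : complex.Im (- z) = - complex.Im z.
Proof. by case: z. Qed.

Lemma ReD (z z' : R[i]) : complex.Re (z + z') = complex.Re z + complex.Re z'.
Proof. by case: z => ? ?; case: z'. Qed.

Lemma Re_sum (I : finType) (F : I -> R[i]) :
  complex.Re (\sum_i F i) = \sum_i complex.Re (F i).
Proof. by apply: (big_morph _ ReD). Qed.

Lemma Im_sum (I : finType) (F : I -> R[i]) :
  complex.Im (\sum_i F i) = \sum_i complex.Im (F i).
Proof. by apply: (big_morph _ ImD). Qed.

Lemma subC_neq0 (x y r : R) : y != 0 -> (Complex x y) - r%:C%C != 0.
Proof. by move=> y0; rewrite eq_complex /= subr0 (negPf y0) andbF. Qed.

Lemma Im_pole (x y r s : R) :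
  complex.Im (r%:C%C / (Complex x y - s%:C%C)) = - y * (r / ((x - s) ^+ 2 + y ^+ 2)).
Proof. by rewrite /= subr0 mul0r addr0; ring. Qed.

Lemma Re_pole (x y r s : R) :
  complex.Re (r%:C%C / (Complex x y - s%:C%C)) = r * ((x - s) / ((x - s) ^+ 2 + y ^+ 2)).
Proof. by rewrite /= subr0 mul0r subr0. Qed.

Variables (n : nat) (a : 'I_n -> R).

Lemma evalC_nodal z : evalC (nodal a) z = \prod_i (z - (a i)%:C%C).
Proof. by rewrite evalC_prod; apply: eq_bigr => i _; rewrite !evalCE. Qed.

Lemma evalC_nodal_neq0 (x y : R) : y != 0 -> evalC (nodal a) (Complex x y) != 0.
Proof. by move=> y0; rewrite evalC_nodal; apply/prodf_neq0 => i _; exact: subC_neq0. Qed.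

Hypothesis a_inj : injective a.

Lemma partial_fractions P (x y : R) : (size P <= n)%N -> y != 0 ->
  evalC P (Complex x y) / evalC (nodal a) (Complex x y) =
  \sum_i (residue a P i)%:C%C / (Complex x y - (a i)%:C%C).
Proof.
move=> sP y0; rewrite [in LHS](interpolation a_inj sP) evalC_sum mulr_suml.
apply: eq_bigr => i _; rewrite evalCZ -mulrA; congr (_ * _).
rewrite (nodalE a i) evalCM !evalCE invfM mulrCA divff ?mulr1 //.
have := evalC_nodal_neq0 x y0.
by rewrite (nodalE a i) evalCM mulf_eq0 => /norP[].
Qed.

Lemma Im_partial_fractions P (x y : R) : (size P <= n)%N -> y != 0 ->
  complex.Im (evalC P (Complex x y) / evalC (nodal a) (Complex x y)) =
  - y * \sum_i (residue a P i / ((x - a i) ^+ 2 + y ^+ 2)).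
Proof.
move=> sP y0; rewrite partial_fractions // Im_sum mulr_sumr.
by apply: eq_bigr => i _; rewrite Im_pole.
Qed.

Lemma Re_partial_fractions P (x y : R) : (size P <= n)%N -> y != 0 ->
  complex.Re (evalC P (Complex x y) / evalC (nodal a) (Complex x y)) =
  \sum_i residue a P i * ((x - a i) / ((x - a i) ^+ 2 + y ^+ 2)).
Proof.
move=> sP y0; rewrite partial_fractions // Re_sum.
by apply: eq_bigr => i _; rewrite Re_pole.
Qed.

End UpperHalfPlane.

Lemma sqdist_gt0 (R : realType) (x y s : R) : y != 0 -> 0 < (x - s) ^+ 2 + y ^+ 2.
Proof. by move=> y0; rewrite ltr_wpDl ?sqr_ge0 // exprn_even_gt0. Qed.

Lemma sumr_gt0 (R : realType) n (F : 'I_n.+1 -> R) :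
  (forall i, 0 < F i) -> 0 < \sum_i F i.
Proof.
move=> F0; rewrite big_ord_recl ltr_pwDl ?sumr_ge0 // => i _; exact/ltW.
Qed.

(** The ratio is 1 - C / A, and C / A is a positive combination of simple poles 1 / (z - a_i), each
    sending the upper half-plane to the lower one. *)
Lemma Im_nodal_ratio_gt0 (R : realType) n (a b : 'I_n.+1 -> R) (x y : R) :
  interlaced a b -> 0 < y ->
  0 < complex.Im (\prod_i ((Complex x y - (b i)%:C%C) / (Complex x y - (a i)%:C%C))).
Proof.
move=> hab y0; have y1 : y != 0 by rewrite gt_eqF.
have -> : \prod_i ((Complex x y - (b i)%:C%C) / (Complex x y - (a i)%:C%C)) =
    1 - evalC (nodal a - nodal b) (Complex x y) / evalC (nodal a) (Complex x y).
  rewrite prodf_div -!evalC_nodal evalCB mulrBl divff ?evalC_nodal_neq0 //.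
  by rewrite opprB addrC subrK.
rewrite ImD ImN Im_partial_fractions ?nodal_sub_size //; last exact: interlaced_inj_a hab.
rewrite /= add0r -mulNr opprK mulr_gt0 // sumr_gt0 // => i.
by rewrite divr_gt0 ?sqdist_gt0 ?residue_a_gt0.
Qed.

(** * Parametrization of the liquid region *)

(** The imaginary part says that t is the mean of the nodes for the weights e_i / |z - s_i|^2. The
    real part then gives r, and expanding |z - s_i|^2 - |z - t|^2 about t leaves the centered second
    moment, the cross term vanishing by the mean condition. Applied to the a_i with t = chi + eta -
    1 and to the b_i with t = chi. *)
Lemma weighted_pole (R : realType) n (e s : 'I_n.+1 -> R) (x y t r : R) :
  (forall i, 0 < e i) -> \sum_i e i = 1 -> 0 < y ->
  (Complex x y - t%:C%C) * (\sum_i (e i)%:C%C / (Complex x y - (s i)%:C%C)) = r%:C%C ->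
  [/\ \sum_i e i * (s i - t) / ((x - s i) ^+ 2 + y ^+ 2) = 0,
      0 < r &
      1 - r = \sum_i e i * (s i - t) ^+ 2 / ((x - s i) ^+ 2 + y ^+ 2)].
Proof.
move=> e0 e1 y0; have y1 : y != 0 by rewrite gt_eqF.
pose N i := (x - s i) ^+ 2 + y ^+ 2.
have N0 i : N i != 0 by rewrite gt_eqF // sqdist_gt0.
pose g := \sum_i e i * (x - s i) / N i; pose h := \sum_i e i / N i.
have h0 : 0 < h by apply: sumr_gt0 => i; rewrite divr_gt0 // sqdist_gt0.
have -> : \sum_i (e i)%:C%C / (Complex x y - (s i)%:C%C) = Complex g (- y * h).
  have -> : Complex g (- y * h) = g%:C%C + Complex 0 (- y) * h%:C%C.
    by apply/eqP; rewrite eq_complex /=; apply/andP; split; apply/eqP; ring.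
  rewrite /g /h !rmorph_sum mulr_sumr -big_split; apply: eq_bigr => i _ /=.
  have := N0 i; rewrite /N => Ni.
  apply/eqP; rewrite eq_complex /= !(subr0, mul0r, add0r, addr0, oppr0, mulr0).
  by apply/andP; split; apply/eqP; ring.
move=> /eqP; rewrite eq_complex /= !subr0 => /andP[/eqP hre /eqP him].
have hg : g = (x - t) * h by apply: (mulfI y1); lra.
have hr : r = ((x - t) ^+ 2 + y ^+ 2) * h by rewrite -hre hg; ring.
have h1 : \sum_i e i * (s i - t) / N i = 0.
  suff -> : \sum_i e i * (s i - t) / N i = (x - t) * h - g by rewrite hg subrr.
  rewrite /g /h mulr_sumr -sumrB; apply: eq_bigr => i _.
  by field.
split=> //; first by rewrite hr mulr_gt0 // sqdist_gt0.
rewrite -e1 hr /h mulr_sumr -sumrB.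
have -> : \sum_i (e i - ((x - t) ^+ 2 + y ^+ 2) * (e i / N i)) =
    \sum_i e i * (s i - t) ^+ 2 / N i + 2 * (t - x) * \sum_i e i * (s i - t) / N i.
  rewrite mulr_sumr -big_split; apply: eq_bigr => i _ /=.
  by have := N0 i; rewrite /N => Ni; field.
by rewrite h1 mulr0 addr0.
Qed.

(** In partial fractions the ratio is 1 plus poles at v and b, whose residues are nonnegative for
    this ordering of a, v, u, b. *)
Lemma Im_ratio_le0 (R : realType) (x y a v u b : R) :
  0 < y -> a <= v -> v < u -> u <= b ->
  complex.Im ((Complex x y - u%:C%C) * (Complex x y - a%:C%C) /
    ((Complex x y - v%:C%C) * (Complex x y - b%:C%C))) <= 0.
Proof.
move=> y0 av vu ub; have y1 : y != 0 by rewrite gt_eqF.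
have bv : 0 < b - v by rewrite subr_gt0 (lt_le_trans vu).
set z := Complex x y.
have -> : (z - u%:C%C) * (z - a%:C%C) / ((z - v%:C%C) * (z - b%:C%C)) =
    1 + ((b - u) * (b - a) / (b - v))%:C%C / (z - b%:C%C)
      + ((v - a) * (u - v) / (b - v))%:C%C / (z - v%:C%C).
  have zv : z - v%:C%C != 0 by exact: subC_neq0.
  have zb : z - b%:C%C != 0 by exact: subC_neq0.
  have cbv : b%:C%C - v%:C%C != 0 by rewrite -rmorphB fmorph_eq0 gt_eqF.
  rewrite !(rmorphM, rmorphB, fmorphV) /=.
  by field; rewrite zb cbv zv.
rewrite !ImD !Im_pole /= add0r -mulrDr mulNr oppr_le0 mulr_ge0 ?(ltW y0) //.
rewrite addr_ge0 // divr_ge0 ?(ltW (sqdist_gt0 _ _ _)) //;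
by rewrite divr_ge0 ?(ltW bv) // mulr_ge0 // subr_ge0; lra.
Qed.

Section Region.
Variables (R : realType) (m : nat) (a b : 'I_m.+2 -> R).
Hypotheses (hab : interlacing a b) (hsum : \sum_i (b i - a i) = 1).
Local Notation C := (nodal a - nodal b).
Local Notation ca := (residue a C).
Local Notation cb := (residue b C).

Let a_inj : injective a := interlaced_inj_a hab.
Let b_inj : injective b := interlaced_inj_b hab.

Lemma sum_residue_a : \sum_i ca i = 1.
Proof. by rewrite sum_residue ?nodal_sub_size // nodal_sub_coef. Qed.

Lemma sum_residue_b : \sum_i cb i = 1.
Proof. by rewrite sum_residue ?nodal_sub_size // nodal_sub_coef. Qed.

Lemma slope_poly_a (chi eta : R) : slope_poly a b chi eta =
  ('X - (chi + eta - 1)%:P) * C - (1 - eta)%:P * nodal a.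
Proof.
rewrite /slope_poly -/(nodal a) -/(nodal b) !polyCD !polyCN polyC1; ring.
Qed.

Lemma slope_poly_b (chi eta : R) : slope_poly a b chi eta =
  ('X - chi%:P) * C - (1 - eta)%:P * nodal b.
Proof.
rewrite /slope_poly -/(nodal a) -/(nodal b) !polyCD !polyCN polyC1; ring.
Qed.

Lemma slope_equationP (chi eta : R) (z : R[i]) :
  slope_equation (real_complex R \o a) (real_complex R \o b)
    (real_complex R chi) (real_complex R eta) z <->
  evalC (slope_poly a b chi eta) z = 0.
Proof.
rewrite /slope_equation /slope_poly -/(nodal a) -/(nodal b) !evalCE ?evalC1.
by rewrite !evalC_nodal; split => [->|/eqP]; rewrite ?subrr // subr_eq0 => /eqP.
Qed.

Lemma evalC_slope_a (chi eta x y : R) : y != 0 ->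
  evalC (slope_poly a b chi eta) (Complex x y) = 0 ->
  (Complex x y - (chi + eta - 1)%:C%C) *
    (\sum_i (ca i)%:C%C / (Complex x y - (a i)%:C%C)) = (1 - eta)%:C%C.
Proof.
move=> y0; rewrite slope_poly_a !evalCE => /eqP; rewrite subr_eq0 => /eqP e.
rewrite -partial_fractions ?nodal_sub_size // mulrA evalCB e.
by rewrite mulfK // evalC_nodal_neq0.
Qed.

Lemma evalC_slope_b (chi eta x y : R) : y != 0 ->
  evalC (slope_poly a b chi eta) (Complex x y) = 0 ->
  (Complex x y - chi%:C%C) *
    (\sum_i (cb i)%:C%C / (Complex x y - (b i)%:C%C)) = (1 - eta)%:C%C.
Proof.
move=> y0; rewrite slope_poly_b !evalCE => /eqP; rewrite subr_eq0 => /eqP e.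
rewrite -partial_fractions ?nodal_sub_size // mulrA evalCB e.
by rewrite mulfK // evalC_nodal_neq0.
Qed.

Lemma weighted_mean_gt (e s : 'I_m.+2 -> R) (x y t : R) : 0 < y ->
  (forall i, 0 < e i) -> (forall i j : 'I_m.+2, (i < j)%N -> s i < s j) ->
  \sum_i e i * (s i - t) / ((x - s i) ^+ 2 + y ^+ 2) = 0 ->
  s ord0 < t < s ord_max.
Proof.
move=> y0 e0 smono h; have y1 : y != 0 by rewrite gt_eqF.
have s01 := smono ord0 ord_max (ltn0Sn _).
have s0 i : s ord0 <= s i.
  have [->//|/negPf i0] := eqVneq i ord0; apply/ltW/(smono ord0 i).
  by rewrite lt0n; exact: negbT i0.
have s1 i : s i <= s ord_max.
  have [->//|i1] := eqVneq i ord_max; apply/ltW/(smono i ord_max).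
  by rewrite ltn_neqAle -ltnS ltn_ord andbT.
apply/andP; split; rewrite ltNge; apply/negP => ht.
  suff : 0 < \sum_i e i * (s i - t) / ((x - s i) ^+ 2 + y ^+ 2) by rewrite h ltxx.
  rewrite (bigD1 ord_max) //= ltr_pwDl ?sumr_ge0 //.
    by rewrite divr_gt0 ?sqdist_gt0 // mulr_gt0 // subr_gt0; lra.
  move=> i _; rewrite divr_ge0 ?(ltW (sqdist_gt0 _ _ _)) // mulr_ge0 ?(ltW (e0 i)) //.
  by rewrite subr_ge0 (le_trans ht).
suff : 0 < - \sum_i e i * (s i - t) / ((x - s i) ^+ 2 + y ^+ 2) by rewrite h oppr0 ltxx.
rewrite -sumrN (bigD1 ord0) //= ltr_pwDl ?sumr_ge0 //.
  by rewrite -mulNr -mulrN divr_gt0 ?sqdist_gt0 // mulr_gt0 // opprB subr_gt0; lra.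
move=> i _; rewrite -mulNr -mulrN divr_ge0 ?(ltW (sqdist_gt0 _ _ _)) //.
rewrite mulr_ge0 ?(ltW (e0 i)) //.
by rewrite opprB subr_ge0 (le_trans (s1 i)).
Qed.

Lemma interlaced_lift i : interlaced (a \o lift i) (b \o lift i).
Proof.
case: hab => h1 h2; split=> [j|j l jl]; first exact: h1.
by apply: h2; rewrite /= ltnNge leq_bump2 -ltnNge.
Qed.

Lemma polygon_of_root (chi eta x y : R) : 0 < y ->
  evalC (slope_poly a b chi eta) (Complex x y) = 0 ->
  polygon_interior a b (chi, eta).
Proof.
move=> y0 hz; have y1 : y != 0 by rewrite gt_eqF.
have [ha1 ha2 ha3] := weighted_pole (residue_a_gt0 hab) sum_residue_a y0 (evalC_slope_a y1 hz).
have [hb1 _ _] := weighted_pole (residue_b_gt0 hab) sum_residue_b y0 (evalC_slope_b y1 hz).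
have /andP[av _] := weighted_mean_gt y0 (residue_a_gt0 hab) (interlaced_mono_a hab) ha1.
have /andP[_ ub] := weighted_mean_gt y0 (residue_b_gt0 hab) (interlaced_mono_b hab) hb1.
have eta0 : 0 < eta.
  have -> : eta = 1 - (1 - eta) by ring.
  rewrite ha3 (bigD1 ord0) //= ltr_pwDl ?sumr_ge0 //.
    rewrite divr_gt0 ?sqdist_gt0 // mulr_gt0 ?residue_a_gt0 //.
    by rewrite exprn_even_gt0 //= subr_eq0 lt_eqF //; lra.
  move=> i _; rewrite divr_ge0 ?(ltW (sqdist_gt0 _ _ _)) //.
  by rewrite mulr_ge0 ?sqr_ge0 // ltW // residue_a_gt0.
split; [lra | lra | ].
(* In an excluded triangle, a_i <= chi + eta - 1 < chi <= b_i. Isolating the i-th factors, the slope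
   equation equates the ratio of [Im_ratio_le0] with the product over the remaining intervals; these
   still interlace, so its imaginary part is positive. *)
move=> [i /andP[iv iu]].
have hz' := hz; move: hz'; rewrite /slope_poly -/(nodal a) -/(nodal b) !evalCE ?evalC1.
rewrite !evalC_nodal !(bigD1_ord i) //= => /eqP; rewrite subr_eq0 => /eqP e.
have := Im_nodal_ratio_gt0 x (interlaced_lift i) y0.
have := @Im_ratio_le0 R x y (a i) (chi + eta - 1) chi (b i) y0.
set z := Complex x y in e *.
have zv : z - (chi + eta - 1)%:C%C != 0 by exact: subC_neq0.
have zb : z - (b i)%:C%C != 0 by exact: subC_neq0.
have PA : \prod_(j < m.+1) (z - (a (lift i j))%:C%C) != 0.
  by apply/prodf_neq0 => j _; exact: subC_neq0.
have -> : (z - chi%:C%C) * (z - (a i)%:C%C) / ((z - (chi + eta - 1)%:C%C) * (z - (b i)%:C%C))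
   = \prod_j ((z - (b (lift i j))%:C%C) / (z - (a (lift i j))%:C%C)).
  rewrite prodf_div; apply/eqP; rewrite eqr_div ?mulf_neq0 //; apply/eqP.
  rewrite -!mulrA e !(rmorphD, rmorphN, rmorph1); ring.
by move=> h; rewrite ltNge h //; lra.
Qed.

(** Subtracting the two equations makes a real multiple of g = sum_i c_i / (z - a_i) real; as Im g <
    0, the multiple is 0. *)
Lemma slope_root_unique (chi eta chi' eta' x y : R) : 0 < y ->
  evalC (slope_poly a b chi eta) (Complex x y) = 0 ->
  evalC (slope_poly a b chi' eta') (Complex x y) = 0 ->
  (chi, eta) = (chi', eta').
Proof.
move=> y0 h h'; have y1 : y != 0 by rewrite gt_eqF.
have G := evalC_slope_a y1 h; have G' := evalC_slope_a y1 h'.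
pose g := \sum_i (ca i)%:C%C / (Complex x y - (a i)%:C%C).
have Img : complex.Im g < 0.
  rewrite /g -partial_fractions ?nodal_sub_size // Im_partial_fractions ?nodal_sub_size //.
  rewrite mulNr oppr_lt0 mulr_gt0 // sumr_gt0 // => i.
  by rewrite divr_gt0 ?sqdist_gt0 // residue_a_gt0.
have E : (chi' + eta' - (chi + eta))%:C%C * g = (eta' - eta)%:C%C.
  have -> : (eta' - eta)%:C%C = (1 - eta)%:C%C - (1 - eta')%:C%C.
    by rewrite -rmorphB; congr (_%:C%C); ring.
  by rewrite -G -G' -/g !(rmorphD, rmorphN, rmorph1); ring.
have : complex.Im ((chi' + eta' - (chi + eta))%:C%C * g) = 0 by rewrite E.
have -> : complex.Im ((chi' + eta' - (chi + eta))%:C%C * g) =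
    (chi' + eta' - (chi + eta)) * complex.Im g.
  by case: (g) => ? ? /=; rewrite mul0r addr0.
move/eqP; rewrite mulf_eq0 (lt_eqF Img) orbF => /eqP e.
move: E; rewrite e mul0r => /eqP; rewrite eq_sym fmorph_eq0 => /eqP e'.
by congr (_, _); lra.
Qed.

Definition curve_abscissa x y q := moment a ca x y q / mass a ca x y q.
Definition curve_height x y q := spread a ca x y q / (2 * mass a ca x y q).
(* [root_point x y 1] is the point of the plane whose slope equation has the roots
   x +/- i y, a double root if y = 0. *)
Definition root_point x y q : R * R :=
  (curve_abscissa x y q + 1 - curve_height x y q, curve_height x y q).
Definition cofactor_poly x y q : {poly R} :=
  (2 * mass a ca x y q)^-1 *: \sum_i \sum_j
    (ca i * ca j * (a i - a j) ^+ 2 * wprod2 a x y q i j) *: nodal2 a i j.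

(** All terms are nonnegative, and |z - a_j q|^2 vanishes for at most one j; the term of that index
    omits the vanishing factor. *)
Lemma mass_gt0 x y q : [|| x != 0, y != 0 | q != 0] -> 0 < mass a ca x y q.
Proof.
move=> xyq.
have w0 i : 0 <= wprod1 a x y q i.
  by apply: prodr_ge0 => j _; rewrite addr_ge0 ?sqr_ge0.
suff [i wi] : exists i, 0 < wprod1 a x y q i.
  rewrite /mass (bigD1 i) //= ltr_pwDl ?sumr_ge0 //.
    by rewrite mulr_gt0 // residue_a_gt0.
  by move=> j _; rewrite mulr_ge0 // ltW // residue_a_gt0.
have sq j : sqdist a x y q j != 0 -> 0 < sqdist a x y q j.
  by move=> s0; rewrite lt_def s0 addr_ge0 ?sqr_ge0.
have [y0|y0] := eqVneq y 0; last first.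
  by exists ord0; apply: prodr_gt0 => j _; exact: sqdist_gt0.
have [/existsP[i /eqP xi]|/existsPn h] := boolP [exists i, x == a i * q].
  exists i; apply: prodr_gt0 => j ji; apply: sq.
  rewrite /sqdist y0 expr0n addr0 sqrf_eq0 xi -mulrBl mulf_neq0 //.
    by rewrite subr_eq0 (inj_eq a_inj) eq_sym.
  by apply: contraTneq xyq => q0; rewrite xi y0 q0 mulr0 eqxx.
exists ord0; apply: prodr_gt0 => j ji; apply: sq.
by rewrite /sqdist y0 expr0n addr0 sqrf_eq0 subr_eq0.
Qed.

(** [key_identity] over the ring of polynomials, with X the indeterminate and all other data
    constant, divided by twice the mass. *)
Lemma slope_poly_root_point x y q : [|| x != 0, y != 0 | q != 0] ->
  slope_poly a b (root_point x y q).1 (root_point x y q).2 =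
  ((q ^+ 2)%:P * 'X ^+ 2 - (2 * x * q)%:P * 'X + (x ^+ 2 + y ^+ 2)%:P) *
    cofactor_poly x y q.
Proof.
move=> /mass_gt0 M0; have M1 : mass a ca x y q != 0 by rewrite gt_eqF.
have M2 : 2 * mass a ca x y q != 0 by rewrite mulf_neq0 // pnatr_eq0.
have wE i : wprod1 (polyC \o a) x%:P y%:P q%:P i = (wprod1 a x y q i)%:P.
  rewrite /wprod1 rmorph_prod; apply: eq_bigr => j _.
  by rewrite /sqdist /= !(polyCD, polyCN, polyCM, rmorphXn).
have w2E i j : wprod2 (polyC \o a) x%:P y%:P q%:P i j = (wprod2 a x y q i j)%:P.
  rewrite /wprod2 rmorph_prod; apply: eq_bigr => l _.
  by rewrite /sqdist /= !(polyCD, polyCN, polyCM, rmorphXn).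
have massE : mass (polyC \o a) (polyC \o ca) x%:P y%:P q%:P = (mass a ca x y q)%:P.
  by rewrite /mass rmorph_sum; apply: eq_bigr => i _; rewrite wE -polyCM.
have momentE : moment (polyC \o a) (polyC \o ca) x%:P y%:P q%:P = (moment a ca x y q)%:P.
  by rewrite /moment rmorph_sum; apply: eq_bigr => i _; rewrite wE -!polyCM.
have spreadE : spread (polyC \o a) (polyC \o ca) x%:P y%:P q%:P = (spread a ca x y q)%:P.
  rewrite /spread polyCM rmorphXn rmorph_sum; congr (_ * _).
  apply: eq_bigr => i _; rewrite rmorph_sum; apply: eq_bigr => j _ /=.
  by rewrite w2E !(polyCM, polyCB, rmorphXn).
have sumE : \sum_i (polyC \o ca) i = 1.
  by rewrite -(rmorph_sum (@polyC R)) /= sum_residue_a.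
have := @key_identity {poly R} _ (polyC \o a) (polyC \o ca) x%:P y%:P q%:P 'X (nodal a)
  (nodal1 a) (nodal2 a) sumE (nodalE a) (@nodal1E _ _ a) (@nodal2C _ _ a).
rewrite massE momentE spreadE.
have -> : \sum_i (polyC \o ca) i * nodal1 a i = C.
  rewrite [RHS](interpolation a_inj) ?nodal_sub_size //.
  by apply: eq_bigr => i _; rewrite -mul_polyC.
have -> : \sum_i \sum_j (polyC \o ca) i * (polyC \o ca) j *
      ((polyC \o a) i - (polyC \o a) j) ^+ 2 *
      wprod2 (polyC \o a) x%:P y%:P q%:P i j * nodal2 a i j =
    (2 * mass a ca x y q)%:P * cofactor_poly x y q.
  rewrite /cofactor_poly mul_polyC scalerA divff // scale1r.
  apply: eq_bigr => i _; apply: eq_bigr => j _; rewrite /= w2E -mul_polyC.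
  by rewrite !(polyCM, polyCB, polyC_exp).
move=> H; apply: (@mulfI _ (2 * mass a ca x y q)%:P).
  by rewrite polyC_eq0.
transitivity (2 * (('X * (mass a ca x y q)%:P - (moment a ca x y q)%:P) * C
    - (mass a ca x y q)%:P * nodal a) + (spread a ca x y q)%:P * nodal a); last first.
  by rewrite H !(polyCM, polyC_exp, polyCD) /= -!polyC_natr; ring.
rewrite slope_poly_a /root_point /=.
set M := mass _ _ _ _ _ in M1 M2 *.
have -> : moment a ca x y q = curve_abscissa x y q * M by rewrite /curve_abscissa divfK.
have -> : spread a ca x y q = curve_height x y q * (2 * M) by rewrite /curve_height divfK.
by rewrite !(polyCM, polyCD, polyCN, polyC1) -!polyC_natr; ring.
Qed.

Lemma evalC_slope_root_point x y : 0 < y ->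
  evalC (slope_poly a b (root_point x y 1).1 (root_point x y 1).2) (Complex x y) = 0.
Proof.
move=> y0; rewrite slope_poly_root_point ?oner_eq0 ?orbT // evalCM.
have -> : evalC ((1 ^+ 2)%:P * 'X ^+ 2 - (2 * x * 1)%:P * 'X + (x ^+ 2 + y ^+ 2)%:P)
  (Complex x y) = 0; last by rewrite mul0r.
rewrite expr2 [in 'X ^+ 2]expr2 !evalCE.
apply/eqP; rewrite eq_complex /=; apply/andP; split; apply/eqP; ring.
Qed.

Lemma liquid_regionP p :
  liquid_region a b p <-> exists x y, 0 < y /\ p = root_point x y 1.
Proof.
split.
  move: p => [chi eta] [_ [w [w0 /slope_equationP h1 /slope_equationP h2]]].
  case: w w0 h1 h2 => x y /= y1 h1 h2.
  have [y0|y0] := ltP 0 y.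
    exists x, y; split=> //; rewrite [RHS]surjective_pairing.
    exact: slope_root_unique h1 (evalC_slope_root_point x y0).
  have y2 : 0 < - y by rewrite oppr_gt0 lt_neqAle y1.
  exists x, (- y); split=> //; rewrite [RHS]surjective_pairing.
  exact: slope_root_unique h2 (evalC_slope_root_point x y2).
move=> [x [y [y0 ->]]]; have h := evalC_slope_root_point x y0.
split; first by rewrite [root_point _ _ _]surjective_pairing; exact: polygon_of_root h.
exists (Complex x y); split=> /=; first by rewrite gt_eqF.
- exact/slope_equationP.
- by apply/slope_equationP; rewrite -[(_ -i* _)%C]/(conjc (Complex x y)) evalC_conj h conjc0.
Qed.

End Region.

(** * Real-rooted polynomials and forbidden divisors *)

Section RealRooted.
Variable R : realType.
Implicit Types (S : {poly R}).

Definition nsq (z : R[i]) : R := complex.Re z ^+ 2 + complex.Im z ^+ 2.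

Lemma nsqM z w : nsq (z * w) = nsq z * nsq w.
Proof. by case: z => a b; case: w => c d; rewrite /nsq /=; ring. Qed.

Lemma nsqE z : (nsq z)%:C%C = z * conjc z.
Proof.
case: z => u v; apply/eqP; rewrite eq_complex /nsq /=.
by apply/andP; split; apply/eqP; ring.
Qed.

Lemma nsq_gt0 z : z != 0 -> 0 < nsq z.
Proof.
case: z => u v; rewrite eq_complex /= negb_and /nsq /= => /orP[u0|v0].
  by rewrite ltr_pwDl ?sqr_ge0 // exprn_even_gt0.
by rewrite ltr_wpDl ?sqr_ge0 // exprn_even_gt0.
Qed.

Lemma real_rooted S :
  (forall x y, 0 < y -> evalC S (Complex x y) != 0) ->
  exists rs : seq R, S = lead_coef S *: \prod_(r <- rs) ('X - r%:P).
Proof.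
move=> h.
have [rs e] := closed_field_poly_normal (map_poly (real_complex R) S).
have hr z : z \in rs -> z = (complex.Re z)%:C%C.
  move=> zrs; apply/eqP; rewrite eq_complex /= eqxx /=.
  have rz : evalC S z = 0.
    rewrite /evalC e hornerZ horner_prod; apply/eqP; rewrite mulf_eq0 prodf_seq_eq0.
    by apply/orP; right; apply/hasP; exists z; rewrite ?hornerE ?subrr.
  apply/eqP; have [y0|y0|//] := ltgtP (complex.Im z) 0; last first.
    by have := h (complex.Re z) _ y0; case: (z) rz => ? ? /= ->; rewrite eqxx.
  have y1 : 0 < - complex.Im z by rewrite oppr_gt0.
  have := h (complex.Re z) _ y1.
  suff -> : evalC S (Complex (complex.Re z) (- complex.Im z)) = 0 by rewrite eqxx.
  have -> : Complex (complex.Re z) (- complex.Im z) = conjc z by case: (z).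
  by rewrite evalC_conj rz conjc0.
exists (map (@complex.Re R) rs); apply: (@map_poly_inj _ _ (real_complex R)).
rewrite e map_polyZ /= lead_coef_map; congr (_ *: _).
rewrite rmorph_prod big_map; apply: eq_big_seq => z /hr zE.
by rewrite rmorphB /= map_polyX map_polyC /= -zE.
Qed.

(** Every linear factor satisfies |z - r|^2 >= y^2 at z = x + i y. *)
Lemma real_rooted_lower_bound S n (x y : R) :
  (forall x y, 0 < y -> evalC S (Complex x y) != 0) ->
  (size S <= n.+1)%N -> S`_n != 0 ->
  S`_n ^+ 2 * (y ^+ 2) ^+ n <= nsq (evalC S (Complex x y)).
Proof.
move=> /real_rooted[rs e] sS Sn.
have sS' : size S = n.+1.
  apply/eqP; rewrite eqn_leq sS ltnNge; apply: contraNN Sn => ?.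
  by rewrite nth_default.
have lS : lead_coef S = S`_n by rewrite lead_coefE sS'.
have srs : size rs = n.
  move: sS'; rewrite e size_scale ?lS // size_prod_XsubC => -[] //.
have nr (r : R) : nsq r%:C%C = r ^+ 2 by rewrite /nsq /= expr0n /= addr0.
rewrite [in leRHS]e evalCZ nsqM lS nr.
rewrite ler_wpM2l ?sqr_ge0 // -srs; elim: rs {e srs} => [|r rs IH].
  by rewrite big_nil evalC1 -(rmorph1 (real_complex R)) nr expr1n expr0.
rewrite big_cons evalCM nsqM (exprS (y ^+ 2)).
apply: ler_pM; [exact: sqr_ge0 | by rewrite exprn_ge0 ?sqr_ge0 | | exact: IH].
by rewrite !evalCE /nsq /= subr0 lerDr sqr_ge0.
Qed.

(** Induction on the roots: passing from P to (X - r) P replaces P'^2 - P P'' at w by P^2 + (w -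
    r)^2 (P'^2 - P P''). *)
Lemma real_rooted_laguerre S (w : R) :
  (forall x y, 0 < y -> evalC S (Complex x y) != 0) ->
  S.[w] * S^`()^`().[w] <= S^`().[w] ^+ 2.
Proof.
move=> /real_rooted[rs ->]; rewrite !derivZ !hornerZ mulrACA exprMn -expr2.
rewrite ler_wpM2l ?sqr_ge0 //; elim: rs => [|r rs IH].
  by rewrite big_nil -polyC1 !(derivC, hornerC) mulr0 expr0n.
rewrite big_cons; move: (\prod_(_ <- _) _) IH => P IH.
have dE (Q : {poly R}) : (('X - r%:P) * Q)^`() = Q + ('X - r%:P) * Q^`().
  by rewrite derivM derivXsubC mul1r.
rewrite dE derivD dE.
rewrite -subr_ge0 in IH.
have := mulr_ge0 (sqr_ge0 (w - r)) IH; have := sqr_ge0 P.[w].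
rewrite !hornerE; move: P.[w] P^`().[w] P^`()^`().[w] => p p' p'' h1 h2.
rewrite -subr_ge0; apply: le_trans (addr_ge0 h1 h2) _.
by rewrite le_eqVlt; apply/orP; left; apply/eqP; rewrite /=; ring.
Qed.

End RealRooted.

(* With S = U T, the residues of U (X - t) at the nodes sum to 0, and each of
   them is nonnegative. *)
Lemma no_nonneg_factor (R : realType) n (s e : 'I_n -> R) (t : R) (S T : {poly R}) :
  injective s -> (forall i, 0 < e i) ->
  (forall i, residue s S i = e i * (s i - t)) -> (size S + 2 < n + size T)%N ->
  (forall i, 0 <= T.[s i]) -> T %| S -> forall i, s i = t.
Proof.
move=> s_inj e0 hS sS T0 /dvdpP[U SE] i.
have S0 : S.[s i] = 0 -> s i = t.
  move=> h; move: (hS i); rewrite /residue h mul0r => /esym/eqP.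
  by rewrite mulf_eq0 (gt_eqF (e0 i)) subr_eq0 => /eqP.
have [U0|U0] := eqVneq U 0; first by apply: S0; rewrite SE U0 mul0r horner0.
have [T1|T1] := eqVneq T 0; first by apply: S0; rewrite SE T1 mulr0 horner0.
have sU : (size (U * ('X - t%:P))%R < n)%N.
  rewrite size_Mmonic ?monicXsubC // size_XsubC.
  move: sS; rewrite SE size_mul //.
  move: U0 T1; rewrite -!size_poly_gt0; move: (size U) (size T) => u t'; lia.
have rE j : T.[s j] * residue s (U * ('X - t%:P)) j = e j * (s j - t) ^+ 2.
  have := hS j; rewrite /residue SE !hornerM hornerXsubC => h.
  by transitivity (e j * (s j - t) * (s j - t)); [rewrite -h|]; ring.
have r0 j : 0 <= residue s (U * ('X - t%:P)) j.
  have [Tj|Tj] := eqVneq T.[s j] 0.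
    have := rE j; rewrite Tj mul0r => /esym/eqP.
    rewrite mulf_eq0 (gt_eqF (e0 j)) sqrf_eq0 /= => /eqP st.
    by rewrite /residue !hornerE st mulr0 mul0r.
  have Tj0 : 0 < T.[s j] by rewrite lt_def Tj T0.
  by rewrite -(pmulr_rge0 _ Tj0) rE mulr_ge0 ?sqr_ge0 // ltW.
have /eqP := sum_residue0 s_inj sU; rewrite psumr_eq0 // => /allP/(_ i).
rewrite mem_index_enum => /(_ isT) /= /eqP ri; have := rE i.
rewrite ri mulr0 => /esym/eqP.
by rewrite mulf_eq0 (gt_eqF (e0 i)) sqrf_eq0 subr_eq0 /= => /eqP.
Qed.

Section Divisors.
Variables (R : realType) (m : nat) (a b : 'I_m.+2 -> R).
Hypotheses (hab : interlacing a b) (hsum : \sum_i (b i - a i) = 1).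
Local Notation C := (nodal a - nodal b).
Local Notation ca := (residue a C).
Local Notation cb := (residue b C).
Let a_inj : injective a := interlaced_inj_a hab.
Let b_inj : injective b := interlaced_inj_b hab.

Lemma size_slope_poly chi eta : (size (slope_poly a b chi eta) <= m.+3)%N.
Proof.
rewrite slope_poly_a (leq_trans (size_polyD _ _)) // geq_max size_polyN; apply/andP; split.
  rewrite (leq_trans (size_polyMleq _ _)) // size_XsubC add2n /= ltnS.
  exact: nodal_sub_size.
by rewrite mul_polyC (leq_trans (size_scale_leq _ _)) // size_nodal.
Qed.

Lemma coef_slope_poly chi eta : (slope_poly a b chi eta)`_m.+2 = eta.
Proof.
rewrite slope_poly_a coefB coefCM mulrBl coefB coefXM coefCM /=.
have := nodal_monic a; rewrite monicE lead_coefE size_nodal /= => /eqP ->.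
have -> : C`_m.+2 = 0 by rewrite nth_default // nodal_sub_size.
by rewrite nodal_sub_coef hsum; ring.
Qed.

(** One nodal polynomial vanishes at the a_i, the other at the b_i, so there the slope polynomial
    reduces to (X - v) C, respectively (X - chi) C, and its residues have the form asked for by
    [no_nonneg_factor]. The conclusion that all nodes coincide is absurd, there being at least
    two. *)
Lemma slope_poly_no_factor chi eta (T : {poly R}) :
  (size (slope_poly a b chi eta) < m + size T)%N ->
  (forall i, 0 <= T.[a i]) \/ (forall i, 0 <= T.[b i]) ->
  ~ T %| slope_poly a b chi eta.
Proof.
move=> sST T0 dT.
have sS : (size (slope_poly a b chi eta) + 2 < m.+2 + size T)%N by lia.
case: T0 => T0.
  have h i : residue a (slope_poly a b chi eta) i = ca i * (a i - (chi + eta - 1)).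
    rewrite /residue slope_poly_a !hornerE.
    have -> : (nodal a).[a i] = 0 by rewrite (nodalE a i) !hornerE subrr mul0r.
    by ring.
  have h' := no_nonneg_factor a_inj (residue_a_gt0 hab) h sS T0 dT.
  by have /a_inj := etrans (h' ord0) (esym (h' ord_max)).
have h i : residue b (slope_poly a b chi eta) i = cb i * (b i - chi).
  rewrite /residue slope_poly_b !hornerE.
  have -> : (nodal b).[b i] = 0 by rewrite (nodalE b i) !hornerE subrr mul0r.
  by ring.
have h' := no_nonneg_factor b_inj (residue_b_gt0 hab) h sS T0 dT.
by have /b_inj := etrans (h' ord0) (esym (h' ord_max)).
Qed.

Lemma slope_poly_no_quartic chi eta (T : {poly R}) : size T = 5%N ->
  (forall i, 0 <= T.[a i]) \/ (forall i, 0 <= T.[b i]) ->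
  ~ T %| slope_poly a b chi eta.
Proof.
by move=> sT; apply: slope_poly_no_factor; have := size_slope_poly chi eta; lia.
Qed.

(** At height 0 the coefficient of degree m + 2 vanishes, and after this drop in degree a divisor of
    degree 2 is already forbidden. This separates the finite part of the curve from its point at
    infinity. *)
Lemma slope_poly_no_double_root_height0 chi (w : R) :
  ~ ('X - w%:P) ^+ 2 %| slope_poly a b chi 0.
Proof.
apply: slope_poly_no_factor.
  rewrite size_exp_XsubC ltnNge; apply/negP => h.
  have s : size (slope_poly a b chi 0) = m.+3.
    by apply/eqP; rewrite eqn_leq size_slope_poly; lia.
  have := coef_slope_poly chi 0; have /eqP := lead_coefE (slope_poly a b chi 0).
  rewrite s /= => /eqP <- /eqP; rewrite lead_coef_eq0 => /eqP s0.
  by move: s; rewrite s0 size_poly0.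
by left=> i; rewrite horner_exp sqr_ge0.
Qed.

Lemma liquid_of_root chi eta x y : 0 < y ->
  evalC (slope_poly a b chi eta) (Complex x y) = 0 -> liquid_region a b (chi, eta).
Proof.
move=> y0 h; apply/(liquid_regionP hab hsum); exists x, y; split=> //.
rewrite [RHS]surjective_pairing.
by apply: (slope_root_unique hab y0 h); exact: evalC_slope_root_point.
Qed.

Lemma not_liquid_real_rooted p : ~ liquid_region a b p ->
  forall x y, 0 < y -> evalC (slope_poly a b p.1 p.2) (Complex x y) != 0.
Proof.
move=> np x y y0; apply/eqP => h; apply: np.
by rewrite [p]surjective_pairing; exact: liquid_of_root h.
Qed.

Lemma liquid_quadratic p : liquid_region a b p -> exists x y, 0 < y /\
  (('X - x%:P) ^+ 2 + (y ^+ 2)%:P) %| slope_poly a b p.1 p.2.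
Proof.
move=> /(liquid_regionP hab hsum)[x [y [y0 ->]]]; exists x, y; split=> //.
rewrite slope_poly_root_point ?oner_eq0 ?orbT //; apply: dvdp_mulr.
suff -> : ('X - x%:P) ^+ 2 + (y ^+ 2)%:P =
  (1 ^+ 2)%:P * 'X ^+ 2 - (2 * x * 1)%:P * 'X + (x ^+ 2 + y ^+ 2)%:P by [].
by rewrite expr1n mulr1 !(polyCD, polyCM, polyC_exp, polyC1); ring.
Qed.

(** Let z be the non-real root at p. Were a nearby p' not liquid, its slope polynomial would be
    real-rooted, hence bounded below at z in terms of its leading coefficient, which is close to eta
    > 0; but its value at z tends to 0 as p' tends to p. *)
Lemma liquid_open : open (liquid_region a b).
Proof.
rewrite openE => p Dp; have [x [y [y0 pE]]] := (liquid_regionP hab hsum p).1 Dp.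
have h := evalC_slope_root_point hab hsum x y0; rewrite -pE in h.
have eta0 : 0 < p.2 by move: Dp => [+ _]; rewrite [p]surjective_pairing => -[/andP[]].
pose z := Complex x y.
pose cr := complex.Re (evalC C z); pose ci := complex.Im (evalC C z).
pose br := complex.Re (evalC (nodal b) z); pose bi := complex.Im (evalC (nodal b) z).
(* The slope polynomial is affine in (chi, eta) and vanishes at z for p, so its value at z is linear
   in p' - p. *)
have nE (p' : R * R) : nsq (evalC (slope_poly a b p'.1 p'.2) z) =
    ((p'.2 - p.2) * br - (p'.1 - p.1) * cr) ^+ 2 +
    ((p'.2 - p.2) * bi - (p'.1 - p.1) * ci) ^+ 2.
  rewrite -[evalC _ _]subr0 -h !slope_poly_b !evalCE -evalCB -/z /nsq.
  rewrite /cr /ci /br /bi !evalCB.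
  case: (evalC (nodal a) z) => ar ai; case: (evalC (nodal b) z) => br' bi'.
  by rewrite /=; ring.
pose f (p' : R * R) := p'.2 ^+ 2 * (y ^+ 2) ^+ m.+2 -
  (((p'.2 - p.2) * br - (p'.1 - p.1) * cr) ^+ 2 +
    ((p'.2 - p.2) * bi - (p'.1 - p.1) * ci) ^+ 2).
have fc : f p' @[p' --> p] --> f p.
  have c1 : p'.1 @[p' --> p] --> p.1 by exact: cvg_fst.
  have c2 : p'.2 @[p' --> p] --> p.2 by exact: cvg_snd.
  have c (u v : R) : (p'.2 - p.2) * u - (p'.1 - p.1) * v @[p' --> p] -->
      (p.2 - p.2) * u - (p.1 - p.1) * v.
    by apply: cvgB; apply: cvgM; [apply: cvgB|apply: cvg_cst|apply: cvgB|apply: cvg_cst] => //;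
      exact: cvg_cst.
  apply: cvgB; first by apply: cvgM; [rewrite expr2; exact: cvgM|exact: cvg_cst].
  by apply: cvgD; rewrite expr2; apply: cvgM.
have fp : 0 < f p.
  by rewrite /f !subrr !mul0r subrr expr0n addr0 subr0 mulr_gt0 // !exprn_gt0.
have e2 : \forall p' \near p, 0 < p'.2.
  have c2 : p'.2 @[p' --> p] --> p.2 by exact: cvg_snd.
  exact: cvgr_gt c2 _ eta0.
have ef : \forall p' \near p, 0 < f p' by exact: cvgr_gt fc _ fp.
rewrite /interior /=; near=> p'.
apply: contrapT => /not_liquid_real_rooted np.
have := real_rooted_lower_bound x y np (size_slope_poly _ _).
rewrite coef_slope_poly gt_eqF; last by near: p'.
move=> /(_ isT); rewrite nE leNgt => /negP; apply.
by rewrite -subr_gt0; near: p'.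
Unshelve. all: by end_near. Qed.

End Divisors.

(** * The extended curve *)

Section Limits.
Variables (R : realType) (T : Type) (F : set_system T).
Context {FF : Filter F}.

Lemma cvg_sumr (I : finType) (P : pred I) (f : I -> T -> R) (l : I -> R) :
  (forall i, P i -> f i t @[t --> F] --> l i) ->
  \sum_(i | P i) f i t @[t --> F] --> \sum_(i | P i) l i.
Proof. by apply: cvg_big; exact: add_continuous. Qed.

Lemma cvg_prodr (I : finType) (P : pred I) (f : I -> T -> R) (l : I -> R) :
  (forall i, P i -> f i t @[t --> F] --> l i) ->
  \prod_(i | P i) f i t @[t --> F] --> \prod_(i | P i) l i.
Proof. by apply: cvg_big; exact: mul_continuous. Qed.

Variables (n : nat) (a c : 'I_n -> R) (x y q : T -> R) (x0 y0 q0 : R).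
Hypotheses (hx : x t @[t --> F] --> x0) (hy : y t @[t --> F] --> y0)
  (hq : q t @[t --> F] --> q0).

Lemma cvg_sqdist i : sqdist a (x t) (y t) (q t) i @[t --> F] --> sqdist a x0 y0 q0 i.
Proof.
rewrite /sqdist !expr2; under eq_cvg do rewrite !expr2.
have h : x t - a i * q t @[t --> F] --> x0 - a i * q0.
  by apply: cvgB => //; apply: cvgM => //; exact: cvg_cst.
by apply: cvgD; apply: cvgM.
Qed.

Lemma cvg_wprod1 i : wprod1 a (x t) (y t) (q t) i @[t --> F] --> wprod1 a x0 y0 q0 i.
Proof. by apply: cvg_prodr => j _; exact: cvg_sqdist. Qed.

Lemma cvg_wprod2 i j :
  wprod2 a (x t) (y t) (q t) i j @[t --> F] --> wprod2 a x0 y0 q0 i j.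
Proof. by apply: cvg_prodr => l _; exact: cvg_sqdist. Qed.

Lemma cvg_mass : mass a c (x t) (y t) (q t) @[t --> F] --> mass a c x0 y0 q0.
Proof.
by apply: cvg_sumr => i _; apply: cvgM; [exact: cvg_cst|exact: cvg_wprod1].
Qed.

Lemma cvg_moment : moment a c (x t) (y t) (q t) @[t --> F] --> moment a c x0 y0 q0.
Proof.
by apply: cvg_sumr => i _; apply: cvgM; [exact: cvg_cst|exact: cvg_wprod1].
Qed.

Lemma cvg_weighted_pairs (N : 'I_n -> 'I_n -> R) :
  \sum_i \sum_j c i * c j * (a i - a j) ^+ 2 * wprod2 a (x t) (y t) (q t) i j * N i j
    @[t --> F] -->
  \sum_i \sum_j c i * c j * (a i - a j) ^+ 2 * wprod2 a x0 y0 q0 i j * N i j.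
Proof.
apply: cvg_sumr => i _; apply: cvg_sumr => j _; apply: cvgM; last exact: cvg_cst.
by apply: cvgM; [exact: cvg_cst|exact: cvg_wprod2].
Qed.

Lemma cvg_spread : spread a c (x t) (y t) (q t) @[t --> F] --> spread a c x0 y0 q0.
Proof.
have e u v r : spread a c u v r = r * r *
    \sum_i \sum_j c i * c j * (a i - a j) ^+ 2 * wprod2 a u v r i j * 1.
  rewrite /spread expr2; congr (_ * _); apply: eq_bigr => i _; apply: eq_bigr => j _.
  by rewrite mulr1.
rewrite e; under eq_cvg do rewrite e.
by apply: cvgM; [exact: cvgM|exact: cvg_weighted_pairs].
Qed.

End Limits.

Lemma contract_continuous (R : realType) : continuous (@contract R).
Proof.
move=> x; apply/cvgrPdist_lt => e e0.
suff : nbhs x [set t | `|contract x - contract t| < e] by [].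
by apply/(@nbhs_ballP R); exists e.
Qed.

Section Curve.
Variables (R : realType) (m : nat) (a b : 'I_m.+2 -> R).
Hypotheses (hab : interlacing a b) (hsum : \sum_i (b i - a i) = 1).
Local Notation C := (nodal a - nodal b).
Local Notation ca := (residue a C).
Let a_inj : injective a := interlaced_inj_a hab.
Let b_inj : injective b := interlaced_inj_b hab.

Section CvgPoint.
Variables (T : Type) (F : set_system T).
Context {FF : Filter F}.
Variables (x y q : T -> R) (x0 y0 q0 : R).
Hypotheses (hx : x t @[t --> F] --> x0) (hy : y t @[t --> F] --> y0)
  (hq : q t @[t --> F] --> q0) (h0 : [|| x0 != 0, y0 != 0 | q0 != 0]).

Lemma cvg_abscissa : curve_abscissa a b (x t) (y t) (q t) @[t --> F] -->
  curve_abscissa a b x0 y0 q0.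
Proof.
apply: cvgM; first exact: cvg_moment.
by apply: cvgV; [rewrite gt_eqF // mass_gt0|exact: cvg_mass].
Qed.

Lemma cvg_height : curve_height a b (x t) (y t) (q t) @[t --> F] -->
  curve_height a b x0 y0 q0.
Proof.
apply: cvgM; first exact: cvg_spread.
apply: cvgV; first by rewrite gt_eqF // mulr_gt0 // mass_gt0.
by apply: cvgM; [exact: cvg_cst|exact: cvg_mass].
Qed.

Lemma cvg_root_point1 :
  (root_point a b (x t) (y t) (q t)).1 @[t --> F] --> (root_point a b x0 y0 q0).1.
Proof.
apply: cvgB; last exact: cvg_height.
by apply: cvgD; [exact: cvg_abscissa|exact: cvg_cst].
Qed.

Lemma cvg_root_point : root_point a b (x t) (y t) (q t) @[t --> F] --> root_point a b x0 y0 q0.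
Proof. exact: (cvg_pair cvg_root_point1 cvg_height). Qed.

Lemma cvg_cofactor (phi : {linear {poly R} -> R}) :
  phi (cofactor_poly a b (x t) (y t) (q t)) @[t --> F] -->
  phi (cofactor_poly a b x0 y0 q0).
Proof.
have e u v r : phi (cofactor_poly a b u v r) = (2 * mass a ca u v r)^-1 *
    \sum_i \sum_j ca i * ca j * (a i - a j) ^+ 2 * wprod2 a u v r i j * phi (nodal2 a i j).
  rewrite /cofactor_poly linearZ; congr (_ * _); rewrite linear_sum.
  by apply: eq_bigr => i _; rewrite linear_sum; apply: eq_bigr => j _; rewrite linearZ.
rewrite e; under eq_cvg do rewrite e.
apply: cvgM; last exact: cvg_weighted_pairs.
apply: cvgV; first by rewrite gt_eqF // mulr_gt0 // mass_gt0.
by apply: cvgM; [exact: cvg_cst|exact: cvg_mass].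
Qed.

End CvgPoint.

Lemma root_point_homogeneous l x y q : l != 0 ->
  root_point a b (l * x) (l * y) (l * q) = root_point a b x y q.
Proof.
move=> l0; have l2 : l ^+ 2 != 0 by rewrite expf_neq0.
(* With n = m + 2 nodes, [mass], [moment] and [spread] are homogeneous of degree 2 (n - 1);
   [P / l ^+ 2] is that power of l. *)
pose P : R := \prod_(j < m.+2) l ^+ 2.
have P0 : P != 0 by apply/prodf_neq0.
have P1 i : \prod_(j < m.+2 | j != i) l ^+ 2 = P / l ^+ 2.
  by rewrite /P [in RHS](bigD1 i) //= mulrAC divff // mul1r.
have w1 i : wprod1 a (l * x) (l * y) (l * q) i = P / l ^+ 2 * wprod1 a x y q i.
  by rewrite wprod1_scale P1.
have w2 i j : i != j -> l ^+ 2 * wprod2 a (l * x) (l * y) (l * q) i j =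
    P / l ^+ 2 * wprod2 a x y q i j.
  by move=> ij; rewrite wprod2_scale -(P1 i) [in RHS](bigD1 j) 1?eq_sym //= mulrA.
have c0 : P / l ^+ 2 != 0 by rewrite mulf_neq0 ?invr_eq0.
have mE : mass a ca (l * x) (l * y) (l * q) = P / l ^+ 2 * mass a ca x y q.
  by rewrite /mass mulr_sumr; apply: eq_bigr => i _; rewrite w1 mulrCA.
have moE : moment a ca (l * x) (l * y) (l * q) = P / l ^+ 2 * moment a ca x y q.
  by rewrite /moment mulr_sumr; apply: eq_bigr => i _; rewrite w1 mulrCA.
have spE : spread a ca (l * x) (l * y) (l * q) = P / l ^+ 2 * spread a ca x y q.
  rewrite /spread; set S' := \sum_i _; set S := \sum_i _.
  suff h : l ^+ 2 * S' = P / l ^+ 2 * S.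
    by transitivity (q ^+ 2 * (l ^+ 2 * S')); [|rewrite h]; ring.
  rewrite /S' /S !mulr_sumr; apply: eq_bigr => i _.
  rewrite !mulr_sumr; apply: eq_bigr => j _.
  have [->|ij] := eqVneq i j; first by rewrite subrr expr0n !(mulr0, mul0r).
  by rewrite mulrCA (w2 _ _ ij); ring.
have vE : curve_abscissa a b (l * x) (l * y) (l * q) = curve_abscissa a b x y q.
  by rewrite /curve_abscissa mE moE -mulf_div divff // mul1r.
have hE : curve_height a b (l * x) (l * y) (l * q) = curve_height a b x y q.
  by rewrite /curve_height mE spE [2 * _]mulrCA -mulf_div divff // mul1r.
by rewrite /root_point vE hE.
Qed.

(* [contract e : 1 - |contract e|] are homogeneous coordinates of the extended
   real number [e]. *)
Definition ecurve (e : \bar R) : R * R := root_point a b (contract e) 0 (1 - `|contract e|).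

Lemma contract_coord_neq0 (s t : R) :
  [|| s != 0, (1 - `|s|) * t != 0 | (1 - `|s|) * (1 - t) != 0].
Proof.
have [->|//] := eqVneq s 0; rewrite /= normr0 subr0 !mul1r.
by have [->|//] := eqVneq t 0; rewrite /= subr0 oner_eq0.
Qed.

Lemma ecurve_coord_neq0 (e : \bar R) :
  [|| contract e != 0, 0 != 0 :> R | 1 - `|contract e| != 0].
Proof. by have := contract_coord_neq0 (contract e) 0; rewrite mulr0 subr0 mulr1. Qed.

Lemma ecurve_continuous : continuous ecurve.
Proof.
move=> e; have c : contract t @[t --> e] --> contract e by exact: contract_continuous.
apply: cvg_root_point => //; last exact: ecurve_coord_neq0.
  exact: cvg_cst.
by apply: cvgB; [exact: cvg_cst|exact: cvg_norm].
Qed.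

Lemma ecurve_fin w : ecurve w%:E = root_point a b w 0 1.
Proof.
rewrite /ecurve /contract; have w1 : 0 < 1 + `|w| by rewrite ltr_pwDl.
have l0 : (1 + `|w|)^-1 != 0 by rewrite invr_eq0 gt_eqF.
rewrite -[RHS](root_point_homogeneous _ _ _ l0) mulr0 mulr1 mulrC; congr root_point.
rewrite normrM normfV (gtr0_norm w1) mulrC.
by have := lt0r_neq0 w1; move: `|w| => u u1; field.
Qed.

Lemma ecurve_infty : ecurve +oo%E = root_point a b 1 0 0 /\ ecurve -oo%E = root_point a b 1 0 0.
Proof.
rewrite /ecurve /= normrN1 normr1 subrr; split=> //.
have := root_point_homogeneous 1 0 0 (_ : -1 != 0); rewrite mulr1 !mulr0; apply.
by rewrite oppr_eq0 oner_eq0.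
Qed.

Lemma slope_poly_fin w : slope_poly a b (root_point a b w 0 1).1 (root_point a b w 0 1).2 =
  ('X - w%:P) ^+ 2 * cofactor_poly a b w 0 1.
Proof.
rewrite slope_poly_root_point ?oner_eq0 ?orbT //; congr (_ * _).
by rewrite expr1n expr0n addr0 mulr1 !(polyCM, polyC_exp, polyC1); ring.
Qed.

(** Differentiate C / A = sum_i c_i / (X - a_i) and multiply by - A^2. Up to sign, this positive
    number is the determinant of the two linear equations in (v, eta) that express a double root at
    w. *)
Lemma nodal_wronskian (w : R) :
  (C * (nodal a)^`() - C^`() * nodal a).[w] = mass a ca w 0 1.
Proof.
have -> : C * (nodal a)^`() - C^`() * nodal a = \sum_i ca i *: nodal1 a i ^+ 2.
  move: (interpolation a_inj (nodal_sub_size a b)); move: ca => c ->.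
  rewrite (raddf_sum (@deriv R)) !mulr_suml -sumrB; apply: eq_bigr => i _.
  by rewrite /= derivZ (nodalE a i) derivM derivXsubC -!mul_polyC; ring.
rewrite horner_sum; apply: eq_bigr => i _; rewrite hornerZ horner_exp; congr (_ * _).
rewrite /nodal1 horner_prod -prodrXl; apply: eq_bigr => j _.
by rewrite /sqdist hornerXsubC expr0n addr0 mulr1.
Qed.

Lemma nodal_log_deriv n (s : 'I_n -> R) w : (forall i, w != s i) ->
  (nodal s)^`().[w] = (nodal s).[w] * \sum_i (w - s i)^-1.
Proof.
move=> ws; rewrite /nodal; elim: (index_enum _) => [|i r IH].
  by rewrite !big_nil derivC hornerC mulr0.
rewrite !big_cons derivM derivXsubC mul1r hornerD !hornerM IH hornerXsubC.
have wi : w - s i != 0 by rewrite subr_eq0.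
by rewrite mulrDr [X in _ = X + _]mulrAC divff // mul1r mulrA.
Qed.

(** Here Pi = B / A and, by the Wronskian, Sigma is the mass divided by A B. The slope polynomial
    and its derivative vanish at w; the formulas are the solution of these two linear equations. *)
Lemma curve_formulas w : (forall i, w != a i) -> (forall i, w != b i) ->
  (chiF a b w, etaF a b w) = root_point a b w 0 1.
Proof.
move=> wa wb.
have A0 : (nodal a).[w] != 0.
  by rewrite horner_prod; apply/prodf_neq0 => i _; rewrite !hornerE subr_eq0.
have B0 : (nodal b).[w] != 0.
  by rewrite horner_prod; apply/prodf_neq0 => i _; rewrite !hornerE subr_eq0.
have PiE : PiF a b w = (nodal b).[w] / (nodal a).[w].
  rewrite /PiF prodf_div !horner_prod; congr (_ / _);
  by apply: eq_bigr => i _; rewrite !hornerE.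
have M0 : 0 < mass a ca w 0 1 by rewrite mass_gt0 // oner_eq0 !orbT.
have W := nodal_wronskian w.
have SE : SigmaF a b w = mass a ca w 0 1 / ((nodal a).[w] * (nodal b).[w]).
  rewrite -W /SigmaF sumrB.
  have -> : \sum_i (w - b i)^-1 = (nodal b)^`().[w] / (nodal b).[w].
    by rewrite nodal_log_deriv // mulrAC divff // mul1r.
  have -> : \sum_i (w - a i)^-1 = (nodal a)^`().[w] / (nodal a).[w].
    by rewrite nodal_log_deriv // mulrAC divff // mul1r.
  by rewrite derivB !(hornerD, hornerN, hornerM); field; rewrite A0 B0.
have [S0 S1] : (slope_poly a b (root_point a b w 0 1).1 (root_point a b w 0 1).2).[w] = 0 /\
    (slope_poly a b (root_point a b w 0 1).1 (root_point a b w 0 1).2)^`().[w] = 0.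
  rewrite slope_poly_fin; split.
    by rewrite hornerM horner_exp hornerXsubC subrr expr0n mul0r.
  by rewrite expr2 -mulrA derivM hornerD !hornerM hornerXsubC subrr !mul0r mulr0 addr0.
move: S0 S1; rewrite slope_poly_a /=; set h := curve_height _ _ _ _ _.
set v := curve_abscissa _ _ _ _ _.
rewrite !(derivB, derivM, derivC, derivX).
rewrite !(hornerD, hornerN, hornerM, hornerC, hornerX, horner0).
move: W; rewrite derivB !(hornerD, hornerN, hornerM).
rewrite /root_point -/h -/v /chiF /etaF PiE SE.
move: (mass a ca w 0 1) M0 (nodal a).[w] (nodal b).[w] A0 B0.
move=> M M0 A B A0 B0; move: (nodal a)^`().[w] (nodal b)^`().[w] => A' B'.
move=> W S0 S1; have M1 : M != 0 by rewrite gt_eqF.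
have ve : v + 1 - h + h - 1 = v by ring.
rewrite ve in S0 S1.
have C0 : (w - v) * (A - B) = (1 - h) * A by lra.
have wv : (A - B) * A = (w - v) * M.
  rewrite -W mulrBr [in RHS]mulrA C0.
  have -> : A - B = (1 - h) * A' - (w - v) * (A' - B') by lra.
  by ring.
have hE : h = 1 - (A - B) ^+ 2 / M.
  apply: (mulIf M1); apply: (mulIf A0).
  rewrite mulrBl divfK // mulrBl expr2 -[in X in _ = _ - X]mulrA wv.
  by rewrite mulrA [(A - B) * _]mulrC C0; ring.
have vE : v = w - (A - B) * A / M by rewrite wv mulfK //; ring.
by congr (_, _); rewrite ?vE hE; field; rewrite A0 B0 M1.
Qed.

End Curve.

(** * The frontier *)

Section Frontier.
Variables (R : realType) (m : nat) (a b : 'I_m.+2 -> R).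
Hypotheses (hab : interlacing a b) (hsum : \sum_i (b i - a i) = 1).
Let a_inj : injective a := interlaced_inj_a hab.

Lemma near_off_nodes (w : R) (s : 'I_m.+2 -> R) :
  \forall t \near w^', forall i, t != s i.
Proof.
apply: filter_forall => i; have [->|ws] := eqVneq w (s i).
  exact: nbhs_dnbhs_neq.
apply: nbhs_dnbhs; have : t - s i @[t --> w] --> w - s i.
  by apply: cvgB => //; exact: cvg_cst.
move=> /cvgr_neq0; rewrite subr_eq0 => /(_ ws).
by apply: filterS => t; rewrite subr_eq0.
Qed.

Lemma lim_curve (F : set_system R) (l : R * R) : ProperFilter F ->
  (\forall t \near F, forall i, t != a i) ->
  (\forall t \near F, forall i, t != b i) ->
  root_point a b t 0 1 @[t --> F] --> l ->
  (lim (chiF a b t @[t --> F]), lim (etaF a b t @[t --> F])) = l.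
Proof.
move=> FF Fa Fb Fl.
have h : \forall t \near F, root_point a b t 0 1 = (chiF a b t, etaF a b t).
  by apply: filterS2 Fa Fb => t ta tb; rewrite curve_formulas.
rewrite [RHS]surjective_pairing; congr (_, _); apply: cvg_lim => //.
- have : (root_point a b t 0 1).1 @[t --> F] --> l.1.
    by apply: (cvg_comp _ _ Fl); case: (l) => u v; exact: cvg_fst.
  by apply: cvg_trans; apply: near_eq_cvg; apply: filterS h => t ->.
- have : (root_point a b t 0 1).2 @[t --> F] --> l.2.
    by apply: (cvg_comp _ _ Fl); case: (l) => u v; exact: cvg_snd.
  by apply: cvg_trans; apply: near_eq_cvg; apply: filterS h => t ->.
Qed.

(** [root_point] agrees with the formulas off the nodes and is continuous everywhere, so each limit
    in the definition is one of its values. *)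
Lemma frozen_curveE : frozen_curve a b = ecurve a b.
Proof.
apply/funext => -[w| |].
- rewrite ecurve_fin /frozen_curve; case: ifPn => [_|/existsPn h]; last first.
    by apply: (curve_formulas hab hsum) => i; have := h i; rewrite negb_or => /andP[].
  apply: lim_curve; [exact: near_off_nodes|exact: near_off_nodes|].
  apply: cvg_root_point => //; last by rewrite oner_eq0 !orbT.
  + exact: nbhs_dnbhs.
  + exact: cvg_cst.
  + exact: cvg_cst.
- apply: lim_curve.
  + apply: filter_forall => i; near=> t; rewrite gt_eqF //; near: t.
    by apply: nbhs_pinfty_gt; exact: num_real.
  + apply: filter_forall => i; near=> t; rewrite gt_eqF //; near: t.
    by apply: nbhs_pinfty_gt; exact: num_real.
  + under eq_cvg do rewrite -ecurve_fin.
    apply: (@cvg_comp _ _ _ (@EFin R) (ecurve a b) _ (nbhs +oo%E)).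
      2: exact: ecurve_continuous.
    move=> A [M [Mr MA]].
    by exists M; split => // t Mt; apply: MA; rewrite lte_fin.
- apply: lim_curve.
  + apply: filter_forall => i; near=> t; rewrite lt_eqF //; near: t.
    by apply: nbhs_ninfty_lt; exact: num_real.
  + apply: filter_forall => i; near=> t; rewrite lt_eqF //; near: t.
    by apply: nbhs_ninfty_lt; exact: num_real.
  + under eq_cvg do rewrite -ecurve_fin.
    apply: (@cvg_comp _ _ _ (@EFin R) (ecurve a b) _ (nbhs -oo%E)).
      2: exact: ecurve_continuous.
    move=> A [M [Mr MA]].
    by exists M; split => // t Mt; apply: MA; rewrite lte_fin.
Unshelve. all: by end_near. Qed.

(** For q = 0 all distances |z - a_j q| coincide: the weights reduce to the c_i and the height to 0.
    A single point thus closes up the half-plane. *)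
Lemma root_point_infty x y : (x != 0) || (y != 0) -> root_point a b x y 0 = root_point a b 1 0 0.
Proof.
move=> xy; have s0 : x ^+ 2 + y ^+ 2 != 0.
  rewrite paddr_eq0 ?sqr_ge0 // !sqrf_eq0 negb_and.
  exact: xy.
have w x' y' i : wprod1 a x' y' 0 i = \prod_(j | j != i) (x' ^+ 2 + y' ^+ 2).
  by apply: eq_bigr => j _; rewrite /sqdist mulr0 subr0.
pose P (x' y' : R) := \prod_(j < m.+1) (x' ^+ 2 + y' ^+ 2).
have wE x' y' i : wprod1 a x' y' 0 i = P x' y'.
  by rewrite w prodr_const cardC1 card_ord /P prodr_const card_ord.
have vE x' y' : P x' y' != 0 ->
    curve_abscissa a b x' y' 0 = \sum_i residue a (nodal a - nodal b) i * a i.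
  move=> P0; rewrite /curve_abscissa /moment /mass.
  under eq_bigr do rewrite wE.
  under [X in _ / X]eq_bigr do rewrite wE.
  by rewrite -!mulr_suml (sum_residue_a hab hsum) mul1r mulfK.
have hE x' y' : curve_height a b x' y' 0 = 0.
  by rewrite /curve_height /spread expr0n !mul0r.
rewrite /root_point !hE !vE //; apply/prodf_neq0 => j _ //.
Qed.

Lemma height_infty : (root_point a b 1 0 0).2 = 0.
Proof. by rewrite /root_point /curve_height /spread /= expr0n !mul0r. Qed.

Lemma root_point_liquid x y q : 0 < y -> 0 < q -> liquid_region a b (root_point a b x y q).
Proof.
move=> y0 q0; apply/(liquid_regionP hab hsum); exists (x / q), (y / q).
split; first by rewrite divr_gt0.
have qi : q^-1 != 0 by rewrite invr_eq0 gt_eqF.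
by rewrite -(root_point_homogeneous a b x y q qi) mulVf ?gt_eqF // ![q^-1 * _]mulrC.
Qed.

Lemma size_quad (x s : R) : size (('X - x%:P) ^+ 2 + s%:P) = 3%N.
Proof.
rewrite size_polyDl ?size_exp_XsubC //.
by rewrite (leq_ltn_trans (size_polyC_leq1 _)).
Qed.

(** A liquid point at a finite parameter w would have (X - w)^2 times a positive quadratic as a
    divisor, which is a forbidden quartic. The point at infinity has height 0 and lies outside the
    polygon. *)
Lemma ecurve_not_liquid e : ~ liquid_region a b (ecurve a b e).
Proof.
case: e => [w| |].
- rewrite ecurve_fin => /(liquid_quadratic hab hsum)[x [y [y0 d]]].
  have := @slope_poly_no_quartic _ _ a b hab (root_point a b w 0 1).1 (root_point a b w 0 1).2
    (('X - w%:P) ^+ 2 * (('X - x%:P) ^+ 2 + (y ^+ 2)%:P)).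
  have Q0 : ('X - x%:P) ^+ 2 + (y ^+ 2)%:P != 0 by rewrite -size_poly_eq0 size_quad.
  apply.
  + by rewrite size_mul ?expf_neq0 ?polyXsubC_eq0 // size_exp_XsubC size_quad.
  + left=> i; rewrite hornerM hornerD !horner_exp hornerC mulr_ge0 ?sqr_ge0 //.
    by rewrite addr_ge0 ?sqr_ge0.
  + rewrite Gauss_dvdp ?d ?andbT.
      by rewrite (slope_poly_fin hab hsum) dvdp_mulr.
    rewrite coprimep_expl // coprimep_sym coprimep_XsubC rootE hornerD horner_exp hornerC.
    by rewrite hornerXsubC gt_eqF // sqdist_gt0 // gt_eqF.
- have [-> _] := ecurve_infty a b.
  by rewrite [root_point _ _ _ _ _]surjective_pairing height_infty => -[[/andP[+ _]]]; rewrite ltxx.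
- have [_ ->] := ecurve_infty a b.
  by rewrite [root_point _ _ _ _ _]surjective_pairing height_infty => -[[/andP[+ _]]]; rewrite ltxx.
Qed.

(** A compact model of the closed half-plane with infinity: over [-1, 1] x [0, 1] the homogeneous
    coordinates run through |x| + y + q = 1 with y, q >= 0. *)
Definition closed_param (p : R * R) : R * R :=
  root_point a b p.1 ((1 - `|p.1|) * p.2) ((1 - `|p.1|) * (1 - p.2)).

Lemma closed_param_continuous : continuous closed_param.
Proof.
move=> p.
have c1 : p'.1 @[p' --> p] --> p.1 by exact: cvg_fst.
have c2 : p'.2 @[p' --> p] --> p.2 by exact: cvg_snd.
have cn : 1 - `|p'.1| @[p' --> p] --> 1 - `|p.1|.
  by apply: cvgB; [exact: cvg_cst|exact: cvg_norm].
apply: cvg_root_point => //; last exact: contract_coord_neq0.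
- exact: cvgM.
- by apply: cvgM => //; apply: cvgB => //; exact: cvg_cst.
Qed.

Lemma liquid_closure :
  closure (liquid_region a b) `<=` liquid_region a b `|` range (ecurve a b).
Proof.
pose K : set (R * R) := `[-1, 1] `*` `[0, 1].
have cK : closed (closed_param @` K).
  apply: compact_closed; first exact: norm_hausdorff.
  apply: continuous_compact.
    by apply: continuous_subspaceT; exact: closed_param_continuous.
  by apply: compact_setX; exact: segment_compact.
have DK : liquid_region a b `<=` closed_param @` K.
  move=> p /(liquid_regionP hab hsum)[x [y [y0 ->]]].
  have n0 : 0 < 1 + `|x| + y by rewrite -addrA ltr_pwDl // addr_ge0 // ltW.
  have y1 : 0 < 1 + y by rewrite ltr_pwDl // ltW.
  have n1 : 1 - `|x / (1 + `|x| + y)| = (1 + y) / (1 + `|x| + y).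
    rewrite normrM normfV (gtr0_norm n0).
    by have := lt0r_neq0 n0; move: `|x| => u u1; field.
  (* The coordinates (x, y, 1) are rescaled so that |x| + y + q = 1. *)
  exists (x / (1 + `|x| + y), y / (1 + y)).
    split; rewrite /= in_itv /=; last first.
      by rewrite (divr_ge0 (ltW y0) (ltW y1)) ler_pdivrMr // mul1r; lra.
    by rewrite -ler_norml -subr_ge0 n1 (divr_ge0 (ltW y1) (ltW n0)).
  rewrite /closed_param /= n1.
  have l0 : (1 + `|x| + y)^-1 != 0 by rewrite invr_eq0 gt_eqF.
  rewrite -[RHS](root_point_homogeneous a b _ _ _ l0); congr root_point.
  + by rewrite mulrC.
  + by field; rewrite !gt_eqF.
  + by field; rewrite !gt_eqF.
move=> p /(closureS DK); rewrite -(closure_id _).1 //.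
move=> [[s t] [/= + +] <-]; rewrite !in_itv /= -ler_norml => s1 /andP[t0 t1].
rewrite /closed_param /=.
have s0 : 0 <= 1 - `|s| by rewrite subr_ge0.
have [q0|q0] := ltP 0 ((1 - `|s|) * (1 - t)); last first.
  right; exists +oo%E => //; have [-> _] := ecurve_infty a b.
  have q1 : (1 - `|s|) * (1 - t) = 0.
    by apply/eqP; rewrite eq_le q0 mulr_ge0 // subr_ge0.
  have := contract_coord_neq0 s t; rewrite q1 eqxx orbF => /root_point_infty ->.
  by [].
have [y0|y0] := ltP 0 ((1 - `|s|) * t); first by left; exact: root_point_liquid.
right; exists (s / ((1 - `|s|) * (1 - t)))%:E => //; rewrite ecurve_fin.
have y1 : (1 - `|s|) * t = 0 by apply/eqP; rewrite eq_le y0 mulr_ge0.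
rewrite y1; have q1 : (1 - `|s|) * (1 - t) != 0 by rewrite gt_eqF.
rewrite -(root_point_homogeneous a b _ _ _ q1) mulr0 mulr1; congr root_point.
by rewrite mulrC divfK.
Qed.

Lemma ecurve_closure e : closure (liquid_region a b) (ecurve a b e).
Proof.
move=> A nA.
have q0 : 0 <= 1 - `|contract e| by rewrite subr_ge0 contract_le1.
(* At infinity q = 0, and raising y alone would keep it so; q is therefore raised by the same
   amount. *)
have c : root_point a b (contract e) s (1 - `|contract e| + s) @[s --> 0^'+] --> ecurve a b e.
  have s0 : s @[s --> (0 : R)^'+] --> (0 : R) by exact: cvg_within.
  have s1 : 1 - `|contract e| + s @[s --> (0 : R)^'+] --> 1 - `|contract e|.
    by rewrite -[X in _ --> X]addr0; apply: cvgD; first exact: cvg_cst.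
  by apply: (cvg_root_point hab (cvg_cst _) s0 s1); exact: ecurve_coord_neq0.
have h : \forall s \near (0 : R)^'+, A (root_point a b (contract e) s (1 - `|contract e| + s)).
  exact: c nA.
have hp : \forall s \near (0 : R)^'+, 0 < s by exact: nbhs_right_gt.
have [s [As s0]] := filter_ex (filterI h hp).
exists (root_point a b (contract e) s (1 - `|contract e| + s)); split=> //.
by apply: root_point_liquid => //; rewrite ltr_wpDl.
Qed.

Lemma frontier_liquid : frontier (liquid_region a b) = range (ecurve a b).
Proof.
rewrite /frontier ((interior_id _).1 (liquid_open hab hsum)); apply/seteqP; split.
  by move=> p [/liquid_closure[]].
move=> _ [e _ <-]; split; [exact: ecurve_closure|exact: ecurve_not_liquid].
Qed.

Lemma ecurve_inj : set_inj [set x : \bar R | (x < +oo)%E] (ecurve a b).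
Proof.
have inf_fin w : ecurve a b w%:E = ecurve a b -oo%E -> False.
  have [_ ->] := ecurve_infty a b; rewrite ecurve_fin => e.
  have := slope_poly_fin hab hsum w; rewrite e height_infty => d.
  apply: (@slope_poly_no_double_root_height0 _ _ _ _ hab hsum (root_point a b 1 0 0).1 w).
  by rewrite d dvdp_mulr.
move=> [u| |] [v| |] //; rewrite !inE //=.
- move=> _ _; rewrite !ecurve_fin => e; apply: contrapT => uv.
  have {}uv : u != v by apply/eqP => uv'; apply: uv; rewrite uv'.
  have := @slope_poly_no_quartic _ _ a b hab (root_point a b u 0 1).1 (root_point a b u 0 1).2
    (('X - u%:P) ^+ 2 * ('X - v%:P) ^+ 2).
  apply.
  + by rewrite size_mul ?expf_neq0 ?polyXsubC_eq0 // !size_exp_XsubC.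
  + by left=> i; rewrite hornerM !horner_exp mulr_ge0 ?sqr_ge0.
  + rewrite Gauss_dvdp.
      rewrite {1}(slope_poly_fin hab hsum) dvdp_mulr // e (slope_poly_fin hab hsum).
      by rewrite dvdp_mulr.
    rewrite coprimep_expl // coprimep_expr // coprimep_XsubC root_XsubC.
    by rewrite eq_sym.
- by move=> _ _ /inf_fin.
- by move=> _ _ /esym /inf_fin.
Qed.

Lemma ecurve_bij : set_bij [set x : \bar R | (x < +oo)%E]
  (frontier (liquid_region a b)) (ecurve a b).
Proof.
rewrite frontier_liquid; split; [by move=> e _; exists e|exact: ecurve_inj|].
move=> _ [[w| |] _ <-]; [by exists w%:E => //=; rewrite ltry| |by exists -oo%E].
by exists -oo%E => //; have [-> ->] := ecurve_infty a b.
Qed.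

End Frontier.

(** * Winding number *)

Section Angle.
Variable R : realType.
Implicit Types (f g : \bar R -> R[i]).

(* [f] never vanishes, and a continuous determination of its argument on the
   extended line grows by [tau] from -oo to +oo. *)
Definition has_angle f (tau : R) : Prop := exists theta : \bar R -> R,
  [/\ continuous theta,
      forall x, exists2 r : R, 0 < r &
        f x = Complex (r * cos (theta x)) (r * sin (theta x)) &
      theta +oo%E - theta -oo%E = tau].

Lemma has_angleM f g s t : has_angle f s -> has_angle g t ->
  has_angle (fun x => f x * g x) (s + t).
Proof.
move=> [u [uc uE us]] [v [vc vE vt]]; exists (fun x => u x + v x); split.
- by move=> x; apply: cvgD; [exact: uc|exact: vc].
- move=> x; have [r r0 ->] := uE x; have [r' r0' ->] := vE x.
  exists (r * r'); first exact: mulr_gt0.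
  by rewrite cosD sinD; apply/eqP; rewrite eq_complex /=; apply/andP; split;
    apply/eqP; ring.
- by rewrite -us -vt; ring.
Qed.

Lemma has_angle_conj f s : has_angle f s -> has_angle (fun x => conjc (f x)) (- s).
Proof.
move=> [u [uc uE us]]; exists (fun x => - u x); split.
- by move=> x; apply: cvgN; exact: uc.
- by move=> x; have [r r0 ->] := uE x; exists r => //; rewrite cosN sinN mulrN.
- by rewrite -us; ring.
Qed.

Lemma has_angle_scale f g s : has_angle f s ->
  (forall x, exists2 c : R, 0 < c & f x = c%:C%C * g x) -> has_angle g s.
Proof.
move=> [u [uc uE us]] fg; exists u; split=> // x.
have [r r0 fE] := uE x; have [c c0 fE'] := fg x.
exists (r / c); first exact: divr_gt0.
have c1 : c%:C%C != 0 :> R[i] by rewrite fmorph_eq0 gt_eqF.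
apply: (mulfI c1); rewrite -fE' fE; apply/eqP; rewrite eq_complex /=.
by apply/andP; split; apply/eqP; field; rewrite gt_eqF.
Qed.

Lemma sin_atan (t : R) : sin (atan t) = t / Num.sqrt (1 + t ^+ 2).
Proof.
rewrite -cos_atan -{2}[t]atanK /tan divfK // cos_atan invr_eq0 gt_eqF //.
by rewrite sqrtr_gt0 ltr_pwDl ?sqr_ge0.
Qed.

(** The principal argument through tan (theta / 2) = sin theta / (1 + cos theta), continuous off the
    closed negative real half-axis. *)
Definition slit_arg (z : R[i]) : R :=
  2 * atan (complex.Im z / (Num.sqrt (nsq z) + complex.Re z)).

Lemma has_angle_slit f :
  continuous (fun x => complex.Re (f x)) -> continuous (fun x => complex.Im (f x)) ->
  (forall x, 0 < complex.Re (f x) \/ complex.Im (f x) != 0) ->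
  has_angle f (slit_arg (f +oo%E) - slit_arg (f -oo%E)).
Proof.
move=> cre cim fS; exists (fun x => slit_arg (f x)).
have n0 x : 0 < Num.sqrt (nsq (f x)).
  rewrite sqrtr_gt0 /nsq; case: (fS x) => h; last first.
    by rewrite ltr_wpDl ?sqr_ge0 // exprn_even_gt0.
  by rewrite ltr_pwDl ?sqr_ge0 // exprn_even_gt0 //= gt_eqF.
have nE x : Num.sqrt (nsq (f x)) ^+ 2 = complex.Re (f x) ^+ 2 + complex.Im (f x) ^+ 2.
  by rewrite sqr_sqrtr // addr_ge0 ?sqr_ge0.
have d0 x : 0 < Num.sqrt (nsq (f x)) + complex.Re (f x).
  case: (fS x) => h; first by rewrite addr_gt0.
  have : complex.Re (f x) ^+ 2 < Num.sqrt (nsq (f x)) ^+ 2.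
    by rewrite nE ltrDl exprn_even_gt0.
  rewrite -[_ ^+ 2]real_normK ?num_real // ltr_pXn2r ?nnegrE ?normr_ge0 ?(ltW (n0 x)) //.
  by rewrite ltr_norml => /andP[]; lra.
split=> //.
- move=> x; apply: cvgM; first exact: cvg_cst.
  apply: (@continuous_cvg _ _ _ _ _ _ (@atan R)); first exact: continuous_atan.
  apply: cvgM; first exact: cim.
  apply: cvgV; first by rewrite gt_eqF.
  apply: cvgD; last exact: cre.
  apply: (@continuous_cvg _ _ _ _ _ _ (@Num.sqrt R)); first exact: sqrt_continuous.
  rewrite /nsq !expr2; under eq_cvg do rewrite !expr2.
  by apply: cvgD; apply: cvgM; (exact: cre || exact: cim).
- move=> x; exists (Num.sqrt (nsq (f x))) => //.
  rewrite /slit_arg mulr_natl cos_mulr2n sin_mulr2n cos_atan sin_atan.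
  have := nE x; have := n0 x; have := d0 x.
  case: (f x) => p q; rewrite /=; move: (Num.sqrt _) => n d0x n0x nEx.
  set t := q / (n + p).
  have t1 : 1 + t ^+ 2 = 2 * n / (n + p).
    have -> : 2 * n / (n + p) = ((n + p) ^+ 2 + (n ^+ 2 - p ^+ 2)) / (n + p) ^+ 2.
      by field; rewrite gt_eqF.
    by rewrite nEx /t; field; rewrite gt_eqF.
  have s0 : 0 < 1 + t ^+ 2 by rewrite ltr_pwDl ?sqr_ge0.
  have sE : Num.sqrt (1 + t ^+ 2) ^+ 2 = 2 * n / (n + p) by rewrite sqr_sqrtr ?t1 // -t1 ltW.
  have sq0 : 0 < Num.sqrt (1 + t ^+ 2) by rewrite sqrtr_gt0.
  move: (Num.sqrt (1 + t ^+ 2)) sE sq0 => u uE u0.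
  have u1 : u != 0 by rewrite gt_eqF.
  have uV : u^-1 ^+ 2 = (n + p) / (2 * n).
    by rewrite exprVn uE invf_div.
  apply/eqP; rewrite eq_complex /=; apply/andP; split; apply/eqP.
    by rewrite uV -mulr_natl; field; rewrite gt_eqF.
  have -> : n * (u^-1 * (t / u) *+ 2) = 2 * n * t * u^-1 ^+ 2 by rewrite -mulr_natl; ring.
  by rewrite uV /t; field; rewrite !gt_eqF.
Qed.

Lemma has_angle_slit_loop f :
  continuous (fun x => complex.Re (f x)) -> continuous (fun x => complex.Im (f x)) ->
  (forall x, 0 < complex.Re (f x) \/ complex.Im (f x) != 0) ->
  f +oo%E = f -oo%E -> has_angle f 0.
Proof.
move=> cre cim fS fE; rewrite -(subrr (slit_arg (f +oo%E))) {2}fE.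
exact: has_angle_slit.
Qed.

Lemma slit_arg_half_turn (c : R) : 0 < c ->
  slit_arg (Complex 0 c) - slit_arg (Complex 0 (- c)) = pi.
Proof.
move=> c0; rewrite /slit_arg /nsq /= !expr0n !add0r !addr0 sqrrN sqrtr_sqr (gtr0_norm c0).
by rewrite mulNr divff ?gt_eqF // atanN atan1; field.
Qed.

End Angle.

(** * The curve seen from a liquid point *)

Section Winding.
Variables (R : realType) (m : nat) (a b : 'I_m.+2 -> R).
Hypotheses (hab : interlacing a b) (hsum : \sum_i (b i - a i) = 1).
Local Notation C := (nodal a - nodal b).
Local Notation ca := (residue a C).
Let a_inj : injective a := interlaced_inj_a hab.
Let b_inj : injective b := interlaced_inj_b hab.

Definition ecofactor (e : \bar R) := cofactor_poly a b (contract e) 0 (1 - `|contract e|).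
Definition eabscissa (e : \bar R) := curve_abscissa a b (contract e) 0 (1 - `|contract e|).
(** The extra factor X - v makes all residues of the cofactor at the nodes nonnegative, so that the
    quotient by A takes values in the lower half-plane and cannot wind. *)
Definition epencil (e : \bar R) := ('X - (eabscissa e)%:P) * ecofactor e.

Lemma abscissaE e : (ecurve a b e).1 + (ecurve a b e).2 - 1 = eabscissa e.
Proof. by rewrite /ecurve /root_point /=; rewrite /eabscissa; ring. Qed.

Lemma slope_poly_ecurve e : slope_poly a b (ecurve a b e).1 (ecurve a b e).2 =
  ((1 - `|contract e|)%:P * 'X - (contract e)%:P) ^+ 2 * ecofactor e.
Proof.
rewrite slope_poly_root_point ?ecurve_coord_neq0 //; congr (_ * _).
by rewrite expr0n addr0 !(polyCM, polyC_exp, polyCD, polyCN); ring.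
Qed.

Lemma size_nodal2 i j : i != j -> size (nodal2 a i j) = m.+1.
Proof.
move=> ij; have := size_nodal1 a i; rewrite (nodal1E a ij) size_monicM ?monicXsubC //.
  by rewrite size_XsubC add2n /= => -[].
apply/monic_neq0/monic_prod => l _; exact: monicXsubC.
Qed.

Lemma size_epencil e : (size (epencil e) <= m.+2)%N.
Proof.
rewrite (leq_trans (size_polyMleq _ _)) // size_XsubC add2n /= ltnS.
rewrite (leq_trans (size_scale_leq _ _)) //.
apply: (leq_trans (size_sum _ _ _)); apply/bigmax_leqP => i _.
apply: (leq_trans (size_sum _ _ _)); apply/bigmax_leqP => j _.
have [->|ij] := eqVneq i j; first by rewrite subrr expr0n mulr0 mul0r scale0r size_poly0.
by rewrite (leq_trans (size_scale_leq _ _)) // size_nodal2.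
Qed.

(** At a node, the two expressions of the slope polynomial give (a_i - v) C(a_i) and (q a_i - s)^2
    times the cofactor, where [s : q] is the curve parameter; multiply both by a_i - v. *)
Lemma residue_epencil e i :
  ((1 - `|contract e|) * a i - contract e) ^+ 2 * residue a (epencil e) i =
  ca i * (a i - eabscissa e) ^+ 2.
Proof.
have A0 : (nodal a).[a i] = 0 by rewrite (nodalE a i) hornerM hornerXsubC subrr mul0r.
have h : (a i - eabscissa e) * C.[a i] =
    ((1 - `|contract e|) * a i - contract e) ^+ 2 * (ecofactor e).[a i].
  have := congr1 (fun P => P.[a i]) (slope_poly_ecurve e).
  rewrite slope_poly_a abscissaE.
  by rewrite !expr2 !(hornerD, hornerN, hornerM, hornerC, hornerX) A0 mulr0 subr0.
rewrite /residue /epencil hornerM hornerXsubC.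
move: C.[a i] (ecofactor e).[a i] (nodal1 a i).[a i]^-1 h => P E N h.
transitivity ((a i - eabscissa e) * ((a i - eabscissa e) * P) * N); last by ring.
by rewrite h; ring.
Qed.

Lemma residue_epencil_ge0 e i : 0 <= residue a (epencil e) i.
Proof.
have c0 := residue_a_gt0 hab i; have h := residue_epencil e i.
have [q0|q0] := eqVneq ((1 - `|contract e|) * a i - contract e) 0; last first.
  have q1 : 0 < ((1 - `|contract e|) * a i - contract e) ^+ 2 by rewrite exprn_even_gt0.
  by rewrite -(pmulr_rge0 _ q1) h mulr_ge0 ?sqr_ge0 // ltW.
(* When the parameter is the node a_i itself, the identity forces v = a_i, and the residue is 0. *)
move/eqP: h; rewrite q0 expr0n mul0r eq_sym mulf_eq0 (gt_eqF c0) sqrf_eq0 /= => /eqP av.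
by rewrite /residue /epencil hornerM hornerXsubC av mul0r mul0r.
Qed.

Lemma residue_epencil_gt0 e : exists i, 0 < residue a (epencil e) i.
Proof.
have [i iv] : exists i, a i != eabscissa e.
  have [h|h] := eqVneq (a ord0) (eabscissa e); last by exists ord0.
  by exists ord_max; rewrite -h (inj_eq a_inj).
exists i; rewrite lt_def residue_epencil_ge0 andbT; apply/eqP => r0.
have /eqP := residue_epencil e i; rewrite r0 mulr0 eq_sym mulf_eq0.
by rewrite (gt_eqF (residue_a_gt0 hab i)) sqrf_eq0 subr_eq0 (negPf iv).
Qed.

Lemma ecofactor_infty : ecofactor +oo%E = ecofactor -oo%E.
Proof.
have e1 := slope_poly_ecurve +oo%E; have e2 := slope_poly_ecurve -oo%E.
have [h1 h2] := ecurve_infty a b.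
rewrite h1 in e1; rewrite h2 in e2; move: e2; rewrite e1 /= normrN1 normr1 subrr mul0r !sub0r.
by rewrite polyCN opprK sqrrN polyC1 expr1n !mul1r.
Qed.

Lemma eabscissa_infty : eabscissa +oo%E = eabscissa -oo%E.
Proof. by rewrite -!abscissaE; have [-> ->] := ecurve_infty a b. Qed.

Lemma eabscissa_continuous : continuous eabscissa.
Proof.
move=> e; have c : contract t @[t --> e] --> contract e by exact: contract_continuous.
apply: cvg_abscissa => //; last exact: ecurve_coord_neq0.
  exact: cvg_cst.
by apply: cvgB; [exact: cvg_cst|exact: cvg_norm].
Qed.

Lemma residue_epencil_continuous i : continuous (fun e => residue a (epencil e) i).
Proof.
have h t : residue a (epencil t) i =
    (a i - eabscissa t) * horner_eval (a i) (ecofactor t) / (nodal1 a i).[a i].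
  by rewrite /residue /epencil hornerM hornerXsubC.
rewrite (funext h) => e.
have c : contract t @[t --> e] --> contract e by exact: contract_continuous.
apply: cvgM; last exact: cvg_cst.
apply: cvgM; first by apply: cvgB; [exact: cvg_cst|exact: eabscissa_continuous].
apply: cvg_cofactor => //; last exact: ecurve_coord_neq0.
  exact: cvg_cst.
by apply: cvgB; [exact: cvg_cst|exact: cvg_norm].
Qed.

Section AroundPoint.
Variables (x0 y0 : R).
Hypothesis y0_gt0 : 0 < y0.
Let z0 := Complex x0 y0.
Let y1 : y0 != 0. Proof. by rewrite gt_eqF. Qed.

(** This is - i (q z0 - s) for the parameter [s : q]. It goes from - i to i with positive real part
    in between, which is half a turn; its square carries the whole winding. *)
Lemma has_angle_turn : has_angle
  (fun e : \bar R =>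
    Complex (y0 * (1 - `|contract e|)) (contract e - x0 * (1 - `|contract e|))) pi.
Proof.
have cq : continuous (fun e : \bar R => 1 - `|contract e|).
  by move=> e; apply: cvgB; [exact: cvg_cst|apply: cvg_norm; exact: contract_continuous].
have -> : pi = slit_arg (Complex 0 (1 : R)) - slit_arg (Complex 0 (- 1)).
  by rewrite slit_arg_half_turn.
set f := fun e => _.
have -> : Complex 0 1 = f +oo%E by rewrite /f /= normr1 subrr !mulr0 subr0.
have -> : Complex 0 (- 1) = f -oo%E by rewrite /f /= normrN1 subrr !mulr0 subr0.
apply: has_angle_slit => e.
- by apply: cvgM; [exact: cvg_cst|exact: cq].
- apply: cvgB; first exact: contract_continuous.
  by apply: cvgM; [exact: cvg_cst|exact: cq].
rewrite /f /=; have := contract_le1 e; rewrite -subr_ge0 le_eqVlt => /orP[/eqP q0|q0].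
  right; rewrite -q0 mulr0 subr0; have := ecurve_coord_neq0 e.
  by rewrite -q0 eqxx orbF.
by left; rewrite mulr_gt0.
Qed.

Definition elower (e : \bar R) := evalC (epencil e) z0 / evalC (nodal a) z0.

Lemma Im_elower e : complex.Im (elower e) < 0.
Proof.
rewrite /elower Im_partial_fractions ?size_epencil // mulNr oppr_lt0 mulr_gt0 //.
have [i ri] := residue_epencil_gt0 e; rewrite (bigD1 i) //= ltr_pwDl //.
  by rewrite divr_gt0 ?sqdist_gt0.
rewrite sumr_ge0 // => j _.
by rewrite divr_ge0 ?residue_epencil_ge0 // ltW // sqdist_gt0.
Qed.

Lemma has_angle_elower : has_angle elower 0.
Proof.
apply: has_angle_slit_loop.
- under eq_fun do rewrite Re_partial_fractions ?size_epencil //.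
  move=> e; apply: cvg_sumr => i _.
  by apply: cvgM; [exact: residue_epencil_continuous|exact: cvg_cst].
- under eq_fun do rewrite Im_partial_fractions ?size_epencil //.
  move=> e; apply: cvgM; first exact: cvg_cst.
  apply: cvg_sumr => i _.
  by apply: cvgM; [exact: residue_epencil_continuous|exact: cvg_cst].
- by move=> e; right; rewrite lt_eqF // Im_elower.
- by rewrite /elower /epencil ecofactor_infty eabscissa_infty.
Qed.

Lemma has_angle_abscissa : has_angle (fun e => conjc (z0 - (eabscissa e)%:C%C)) 0.
Proof.
apply: has_angle_slit_loop.
- by move=> e /=; apply: cvgB; [exact: cvg_cst|exact: eabscissa_continuous].
- by move=> e /=; exact: cvg_cst.
- by move=> e; right; rewrite /= subr0 oppr_eq0.
- by rewrite eabscissa_infty.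
Qed.

Lemma has_angle_cst (k : R[i]) : complex.Im k != 0 -> has_angle (fun _ : \bar R => k) 0.
Proof.
by move=> k0; apply: has_angle_slit_loop => //; [move=> e; exact: cvg_cst
  |move=> e; exact: cvg_cst|right].
Qed.

End AroundPoint.

Lemma Im_inv_gt0 (k : R[i]) : complex.Im k < 0 -> 0 < complex.Im k^-1.
Proof.
case: k => u v /= v0; rewrite -mulNr divr_gt0 ?oppr_gt0 //.
by rewrite ltr_wpDl ?sqr_ge0 // exprn_even_gt0 //= lt_eqF.
Qed.

Lemma ecurve_coord_continuous (e : \bar R) :
  ((ecurve a b t).1 @[t --> e] --> (ecurve a b e).1) /\
  ((ecurve a b t).2 @[t --> e] --> (ecurve a b e).2).
Proof.
have c : contract t @[t --> e] --> contract e by exact: contract_continuous.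
have q : 1 - `|contract t| @[t --> e] --> 1 - `|contract e|.
  by apply: cvgB; [exact: cvg_cst|exact: cvg_norm].
split.
  by apply: (cvg_root_point1 hab c (cvg_cst _) q); exact: ecurve_coord_neq0.
by apply: (cvg_height hab c (cvg_cst _) q); exact: ecurve_coord_neq0.
Qed.

Lemma ecurve_winding p : liquid_region a b p -> winds_once_clockwise (ecurve a b) p.
Proof.
move=> Dp; have [x [y [y0 pE]]] := (liquid_regionP hab hsum p).1 Dp.
have y1 : y != 0 by rewrite gt_eqF.
pose z := Complex x y.
have Sp : evalC (slope_poly a b p.1 p.2) z = 0.
  by rewrite pE; exact: evalC_slope_root_point.
have A0 : evalC (nodal a) z != 0 by exact: evalC_nodal_neq0.
have B0 : evalC (nodal b) z != 0 by exact: evalC_nodal_neq0.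
have ImG : complex.Im (evalC C z / evalC (nodal a) z) < 0.
  rewrite Im_partial_fractions ?nodal_sub_size // mulNr oppr_lt0 mulr_gt0 // sumr_gt0 // => i.
  by rewrite divr_gt0 ?sqdist_gt0 // residue_a_gt0.
have ImK : complex.Im (evalC C z / evalC (nodal b) z) < 0.
  rewrite Im_partial_fractions ?nodal_sub_size // mulNr oppr_lt0 mulr_gt0 // sumr_gt0 // => i.
  by rewrite divr_gt0 ?sqdist_gt0 // residue_b_gt0.
have C0 : evalC C z != 0.
  by apply: contraTneq ImG => ->; rewrite mul0r ltxx.
(* Since z is a root for p, the slope polynomial of a curve point takes the value - C(z) (X - k Y)
   at z. As Im k > 0, the linear map sending (X, Y) to X - k Y reverses orientation. *)
pose g := evalC (nodal a) z / evalC C z; pose k := evalC (nodal b) z / evalC C z.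
have g0 : complex.Im g != 0.
  by rewrite gt_eqF // /g -[_ / _]invrK invf_div Im_inv_gt0.
have k0 : 0 < complex.Im k by rewrite /k -[_ / _]invrK invf_div Im_inv_gt0.
pose X e := (ecurve a b e).1 - p.1; pose Y e := (ecurve a b e).2 - p.2.
have XY0 e : ~ (X e = 0 /\ Y e = 0).
  move=> [/eqP + /eqP]; rewrite !subr_eq0 => /eqP h1 /eqP h2.
  apply: (@ecurve_not_liquid _ _ _ _ hab hsum e).
  by rewrite [ecurve a b e]surjective_pairing h1 h2 -surjective_pairing.
have Xc : continuous X.
  by move=> e; apply: cvgB; [exact: (ecurve_coord_continuous e).1|exact: cvg_cst].
have Yc : continuous Y.
  by move=> e; apply: cvgB; [exact: (ecurve_coord_continuous e).2|exact: cvg_cst].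
have XYoo : (X +oo%E = X -oo%E) * (Y +oo%E = Y -oo%E).
  by rewrite /X /Y; have [-> ->] := ecurve_infty a b.
pose s := complex.Re k; pose t := complex.Im k.
(* [rho e] is never opposite to the vector (X e, Y e), so that both have the
   same winding; [S e] measures the angle between them. *)
pose rho e := Complex (X e - Y e * s) (t * Y e).
pose turn e := Complex (y * (1 - `|contract e|)) (contract e - x * (1 - `|contract e|)).
(* Each [turn] contributes pi and the other factors nothing. The last one completes the factor z - v
   of [elower] to |z - v|^2, so that E is a positive multiple of the conjugate of [rho]. *)
pose E e := turn e * turn e * g * elower x y e * conjc (z - (eabscissa e)%:C%C).
have EA : has_angle E (pi + pi + 0 + 0 + 0).
  apply: has_angleM; last exact: has_angle_abscissa.
  apply: has_angleM; last exact: has_angle_elower.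
  apply: has_angleM; last exact: has_angle_cst.
  by apply: has_angleM; exact: has_angle_turn.
have rhoE e : E e = (nsq (z - (eabscissa e)%:C%C))%:C%C * conjc (rho e).
  have h : evalC (slope_poly a b (ecurve a b e).1 (ecurve a b e).2) z =
      - (turn e * turn e) * evalC (ecofactor e) z.
    rewrite slope_poly_ecurve expr2 !evalCE; congr (_ * _).
    by apply/eqP; rewrite eq_complex /=; apply/andP; split; apply/eqP; ring.
  have h' : evalC (slope_poly a b (ecurve a b e).1 (ecurve a b e).2) z =
      - (X e)%:C%C * evalC C z + (Y e)%:C%C * evalC (nodal b) z.
    rewrite -[LHS]subr0 -Sp !slope_poly_b !evalCE !(rmorphB, rmorph1) /=; ring.
  have hr : conjc (rho e) = (X e)%:C%C - (Y e)%:C%C * k.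
    rewrite /rho /s /t; case: (k) => u v.
    by apply/eqP; rewrite eq_complex /=; apply/andP; split; apply/eqP; ring.
  have hr' : conjc (rho e) = turn e * turn e * evalC (ecofactor e) z / evalC C z.
    have kC : k * evalC C z = evalC (nodal b) z by rewrite /k divfK.
    apply: (mulIf C0); rewrite divfK // hr mulrBl -[_ * k * _]mulrA kC.
    apply: oppr_inj; transitivity (- (turn e * turn e) * evalC (ecofactor e) z); last by ring.
    by rewrite -h h'; ring.
  rewrite nsqE hr' /E /elower -/z /epencil evalCM [evalC ('X - _) z]evalCB evalCX evalCC /g.
  by field; rewrite A0 C0.
pose S e := Complex (X e) (Y e) * conjc (rho e).
have SA : has_angle S 0.
  apply: has_angle_slit_loop.
  - move=> e; rewrite /S /rho /=.
    apply: cvgB; apply: cvgM; try exact: Xc; try exact: Yc.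
      apply: cvgB; first exact: Xc.
      by apply: cvgM; [exact: Yc|exact: cvg_cst].
    by apply: cvgN; apply: cvgM; [exact: cvg_cst|exact: Yc].
  - move=> e; rewrite /S /rho /=.
    apply: cvgD; apply: cvgM; try exact: Xc; try exact: Yc.
      by apply: cvgN; apply: cvgM; [exact: cvg_cst|exact: Yc].
    apply: cvgB; first exact: Xc.
    by apply: cvgM; [exact: Yc|exact: cvg_cst].
  (* S is real exactly when (X, Y) is an eigenvector of the triangular linear map defining [rho];
     the eigenvalues 1 and t are positive, hence so is S. *)
  - move=> e; rewrite /S /rho /=; have t0 : 0 < t by [].
    have := XY0 e; move: (X e) (Y e) => u v uv0.
    have [im0|] := eqVneq (u * - (t * v) + v * (u - v * s)) 0; last by right.
    left; have [v0|v0] := eqVneq v 0.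
      have u0 : u != 0 by apply/eqP => u0; apply: uv0.
      by rewrite v0 !(mulr0, mul0r, oppr0, subr0) -expr2 exprn_even_gt0.
    have us : u * (1 - t) = s * v.
      by apply: (mulfI v0); lra.
    have -> : u * (u - v * s) - v * - (t * v) = t * (u ^+ 2 + v ^+ 2).
      have -> : u * (u - v * s) - v * - (t * v) = u * (u - s * v) + t * v ^+ 2 by ring.
      by rewrite -us; ring.
    by rewrite mulr_gt0 // ltr_wpDl ?sqr_ge0 // exprn_even_gt0.
  - by rewrite /S /rho !XYoo.
have rho0 e : rho e != 0.
  apply/eqP => h; have := rhoE e; rewrite h conjc0 mulr0.
  have [th [_ thE _]] := EA; have [r r0 ->] := thE e.
  move=> /eqP; rewrite eq_complex /= !mulf_eq0 (gt_eqF r0) /= => /andP[/eqP c /eqP s'].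
  by have := cos2Dsin2 (th e); rewrite c s' expr0n addr0 => /eqP; rewrite eq_sym oner_eq0.
have : has_angle (fun e => Complex (X e) (Y e)) (0 - (pi + pi + 0 + 0 + 0)).
  apply: has_angle_scale (has_angleM SA (has_angle_conj EA)) _ => e.
  exists (nsq (z - (eabscissa e)%:C%C) * nsq (rho e)).
    by rewrite mulr_gt0 // nsq_gt0 // subC_neq0.
  have -> : conjc (E e) = (nsq (z - (eabscissa e)%:C%C))%:C%C * rho e.
    have cM u v : conjc (u * v) = conjc u * conjc v :> R[i] by exact: rmorphM.
    by rewrite rhoE cM conjcK conjc_real.
  have rM (u v : R) : (u * v)%:C%C = u%:C%C * v%:C%C :> R[i] by exact: rmorphM.
  by rewrite rM (nsqE (rho e)) /S; ring.
move=> [th [thc thE tht]]; exists th; split=> //; last by rewrite tht; ring.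
move=> e; have [r r0] := thE e => -[hX hY]; exists r => //.
rewrite [LHS]surjective_pairing -hX -hY /X /Y; apply/eqP; rewrite xpair_eqE /=.
by apply/andP; split; apply/eqP; ring.
Qed.

End Winding.

(** * Sides of the curve *)

Section RightSide.
Variables (R : realType) (m : nat) (a b : 'I_m.+2 -> R).
Hypotheses (hab : interlacing a b) (hsum : \sum_i (b i - a i) = 1).
Local Notation C := (nodal a - nodal b).
Let a_inj : injective a := interlaced_inj_a hab.
Let b_inj : injective b := interlaced_inj_b hab.

(** The affine form vanishes at f(w), so the difference quotient of the form along f is exactly J(w
    + h). *)
Lemma directional_derivative (f : R -> R * R) (w : R) (T : R * R) (al be ga : R) (J : R -> R) :
  is_derive w (1 : R) f T ->
  (forall t, al * (f t).1 + be * (f t).2 + ga = (t - w) * J t) ->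
  J t @[t --> w] --> J w -> al * T.1 + be * T.2 = J w.
Proof.
move=> [df dT] fJ cJ.
have c : h^-1 *: (f (h *: 1 + w) - f w) @[h --> 0^'] --> T.
  by rewrite -dT; exact: df.
have c1 : (h^-1 *: (f (h *: 1 + w) - f w)).1 @[h --> 0^'] --> T.1.
  by apply: (cvg_comp _ _ c); case: (T) => u v; exact: cvg_fst.
have c2 : (h^-1 *: (f (h *: 1 + w) - f w)).2 @[h --> 0^'] --> T.2.
  by apply: (cvg_comp _ _ c); case: (T) => u v; exact: cvg_snd.
have cl : al * (h^-1 *: (f (h *: 1 + w) - f w)).1 + be * (h^-1 *: (f (h *: 1 + w) - f w)).2
    @[h --> 0^'] --> al * T.1 + be * T.2.
  by apply: cvgD; apply: cvgM => //; exact: cvg_cst.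
have cr : J (h + w) @[h --> (0 : R)^'] --> J w.
  apply: (@cvg_comp _ _ _ (fun h => h + w) J _ (nbhs w)) => //.
  have : h + w @[h --> (0 : R)^'] --> 0 + w.
    by apply: cvgD; [exact: nbhs_dnbhs|exact: cvg_cst].
  by rewrite add0r.
apply: (cvg_unique _ cl); first exact: Rhausdorff.
apply: cvg_trans cr; apply: near_eq_cvg.
near=> h; have h0 : h != 0 by near: h; exact: nbhs_dnbhs_neq.
rewrite /= /GRing.scale /= mulr1.
have := fJ (h + w); have := fJ w; rewrite subrr mul0r addrK => e1 e2.
apply: (mulfI h0); rewrite -e2 -[LHS]subr0 -e1.
by field.
Unshelve. all: by end_near. Qed.

Lemma slope_poly_affine (p : R * R) (s u v : R) :
  slope_poly a b (p + s *: (u, v)).1 (p + s *: (u, v)).2 =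
  slope_poly a b p.1 p.2 + s%:P * (v%:P * nodal b - u%:P * C).
Proof.
rewrite !slope_poly_b /= /GRing.scale /= !(polyCD, polyCN, polyCM, polyC1); ring.
Qed.

Section AtPoint.
Variables (w : R) (T : R * R).
Hypotheses (dT : is_derive w (1 : R) (fun t : R => ecurve a b t%:E) T) (T0 : T != 0).
Let M := mass a (residue a C) w 0 1.
Let U t := cofactor_poly a b t 0 1.
Let H := (U w).[w].
(** Derivative of the slope polynomial in the direction of the right-hand normal (T.2, - T.1). *)
Let N : {poly R} := (- T.1)%:P * nodal b - (T.2)%:P * C.

Let M_gt0 : 0 < M. Proof. by rewrite /M mass_gt0 // oner_eq0 !orbT. Qed.

Let dT' : is_derive w (1 : R) (fun t : R => root_point a b t 0 1) T.
Proof.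
have <- : (fun t : R => ecurve a b t%:E) = (fun t : R => root_point a b t 0 1).
  by apply/funext => t; rewrite ecurve_fin.
exact: dT.
Qed.

Let cvgU (phi : {linear {poly R} -> R}) : phi (U t) @[t --> w] --> phi (U w).
Proof.
apply: cvg_cofactor => //; first exact: cvg_cst.
  exact: cvg_cst.
by rewrite oner_eq0 !orbT.
Qed.

Let cvgU0 : (U t).[w] @[t --> w] --> (U w).[w].
Proof.
have h : horner_eval w (U t) @[t --> w] --> horner_eval w (U w) by exact: cvgU.
exact: h.
Qed.

Let cvgU1 : (U t)^`().[w] @[t --> w] --> (U w)^`().[w].
Proof.
have h : (horner_eval w \o (@deriv R)) (U t) @[t --> w] -->
  (horner_eval w \o (@deriv R)) (U w) by exact: cvgU.
exact: h.
Qed.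

(** The slope polynomial of the curve point at t is (X - t)^2 U_t. Evaluating it and its
    X-derivative at w, then differentiating in t at t = w, gives two linear equations for T with
    determinant M up to sign; they yield M T = - 2 H (B(w), C(w)). Hence H = 0 would force T = 0,
    and N(w) has the sign of H. *)
Lemma tangent_direction : H != 0 /\
  M * N.[w] = 2 * H * (C.[w] ^+ 2 + (nodal b).[w] ^+ 2).
Proof.
have cw : t - w @[t --> w] --> 0.
  by rewrite -(subrr w); apply: cvgB => //; exact: cvg_cst.
have e1 : - C.[w] * T.1 + (nodal b).[w] * T.2 = 0.
  have := @directional_derivative _ w T (- C.[w]) (nodal b).[w]
    ('X * C - nodal b).[w] (fun t => (t - w) * (U t).[w]) dT'.
  rewrite subrr mul0r; apply.
    move=> t; have := congr1 (fun P => P.[w]) (slope_poly_fin hab hsum t).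
    rewrite slope_poly_b -/(U t) [RHS]hornerM horner_exp hornerXsubC => h.
    transitivity ((w - t) ^+ 2 * (U t).[w]); last by ring.
    by rewrite -h !(hornerD, hornerN, hornerM, hornerC, hornerX); ring.
  rewrite -[X in _ --> X](mul0r (U w).[w]); apply: cvgM => //.
have e2 : - C^`().[w] * T.1 + (nodal b)^`().[w] * T.2 = - (2 * H).
  have := @directional_derivative _ w T (- C^`().[w]) (nodal b)^`().[w]
    ('X * C - nodal b)^`().[w] (fun t => - (2 * (U t).[w]) + (t - w) * (U t)^`().[w]) dT'.
  rewrite subrr mul0r addr0; apply.
    move=> t; have := congr1 (fun P => P^`().[w]) (slope_poly_fin hab hsum t).
    rewrite slope_poly_b -/(U t).
    have -> : (('X - t%:P) ^+ 2 * U t)^`() =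
       2 * ('X - t%:P) * U t + ('X - t%:P) ^+ 2 * (U t)^`().
      by rewrite derivM expr2 derivM derivXsubC; ring.
    rewrite [RHS]hornerD !hornerM !hornerXsubC => h.
    transitivity (2 * (w - t) * (U t).[w] + (w - t) ^+ 2 * (U t)^`().[w]); last by ring.
    have two : (2 : {poly R}).[w] = 2 by rewrite -polyC_natr hornerC.
    rewrite -two -h !(derivB, derivM, derivX, derivC).
    by rewrite !(hornerD, hornerN, hornerM, hornerC, hornerX, horner0); ring.
  rewrite -[X in _ --> X]addr0; apply: cvgD.
    by apply: cvgN; apply: cvgM; [exact: cvg_cst|exact: cvgU0].
  rewrite -[X in _ --> X](mul0r (U w)^`().[w]); apply: cvgM => //.
have W := nodal_wronskian hab w; rewrite -/M in W.
have {}W : C.[w] * (nodal b)^`().[w] - C^`().[w] * (nodal b).[w] = M.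
  by rewrite -W derivB !(hornerD, hornerN, hornerM); ring.
have -> : N.[w] = - T.1 * (nodal b).[w] - T.2 * C.[w].
  by rewrite /N !(hornerD, hornerN, hornerM, hornerC).
have HM := M_gt0.
move: C.[w] C^`().[w] (nodal b).[w] (nodal b)^`().[w] e1 e2 W => c c' b0 b' e1 e2 W.
have t1 : M * T.1 = - (2 * H * b0).
  transitivity (b0 * (- c' * T.1 + b' * T.2) - b' * (- c * T.1 + b0 * T.2)).
    by rewrite -W; ring.
  by rewrite e1 e2; ring.
have t2 : M * T.2 = - (2 * H * c).
  transitivity (c * (- c' * T.1 + b' * T.2) - c' * (- c * T.1 + b0 * T.2)).
    by rewrite -W; ring.
  by rewrite e1 e2; ring.
split.
  apply: contraNneq T0 => H0; rewrite [T]surjective_pairing xpair_eqE.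
  move: t1 t2; rewrite H0 mulr0 !mul0r oppr0 => /eqP + /eqP.
  by rewrite !mulf_eq0 (gt_eqF HM) /= => -> ->.
transitivity (- (M * T.1) * b0 - (M * T.2) * c); first by ring.
by rewrite t1 t2; ring.
Qed.

Let slopeE : slope_poly a b (ecurve a b w%:E).1 (ecurve a b w%:E).2 =
  ('X - w%:P) ^+ 2 * U w.
Proof. by rewrite ecurve_fin (slope_poly_fin hab hsum). Qed.

Let HN_gt0 : 0 < H * N.[w].
Proof.
have [H0 MN] := tangent_direction.
rewrite -(pmulr_rgt0 _ M_gt0) mulrCA MN mulrA mulrCA -expr2.
have W := nodal_wronskian hab w; have := M_gt0; rewrite {1}/M -W => W0.
have cb : 0 < C.[w] ^+ 2 + (nodal b).[w] ^+ 2.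
  have [c0|c0] := eqVneq C.[w] 0; last by rewrite ltr_pwDl ?sqr_ge0 // exprn_even_gt0.
  rewrite c0 expr0n add0r exprn_even_gt0 //; apply/eqP => b0.
  have a0 : (nodal a).[w] = 0.
    by rewrite -(subrK (nodal b) (nodal a)) hornerD c0 b0 addr0.
  by move: W0; rewrite hornerD hornerN !hornerM a0 c0 mulr0 mul0r subr0 ltxx.
by rewrite mulr_gt0 // mulr_gt0 // exprn_even_gt0.
Qed.

(** To the right the polynomial is S = (X - w)^2 U + s N. At w, S S'' is 2 s H N(w) up to order s^2
    with H N(w) > 0, whereas S'^2 is of order s^2. *)
Lemma right_side_liquid :
  \forall s \near (0 : R)^'+, liquid_region a b (ecurve a b w%:E + s *: (T.2, - T.1)).
Proof.
have c : s * (N^`().[w] ^+ 2 - N.[w] * N^`()^`().[w]) @[s --> (0 : R)^'+] --> 0.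
  rewrite -[X in _ --> X](mul0r (N^`().[w] ^+ 2 - N.[w] * N^`()^`().[w])).
  by apply: cvgM; [exact: cvg_within|exact: cvg_cst].
have HN2 : 0 < 2 * (H * N.[w]) by rewrite mulr_gt0 // HN_gt0.
near=> s.
have s0 : 0 < s by near: s; exact: nbhs_right_gt.
have sK : s * (N^`().[w] ^+ 2 - N.[w] * N^`()^`().[w]) < 2 * (H * N.[w]).
  by near: s; exact: (cvgr_lt _ c _ HN2).
apply: contrapT => /(not_liquid_real_rooted hab hsum) /(real_rooted_laguerre w).
rewrite slope_poly_affine slopeE -/N.
have e0 : (('X - w%:P) ^+ 2 * U w + s%:P * N).[w] = s * N.[w].
  by rewrite !(hornerXsubC, hornerD, hornerM, hornerC) subrr; ring.
have d2 (P : {poly R}) : (('X - w%:P) ^+ 2 * P)^`() =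
    ('X - w%:P) * (2 * P + ('X - w%:P) * P^`()).
  by rewrite derivM expr2 derivM derivXsubC; ring.
have d1 (P : {poly R}) : (('X - w%:P) * P)^`() = P + ('X - w%:P) * P^`().
  by rewrite derivM derivXsubC mul1r.
have dN (P : {poly R}) : (s%:P * P)^`() = s%:P * P^`() by rewrite !mul_polyC derivZ.
have e1 : (('X - w%:P) ^+ 2 * U w + s%:P * N)^`().[w] = s * N^`().[w].
  by rewrite derivD d2 dN !(hornerXsubC, hornerD, hornerM, hornerC) subrr; ring.
have e2 : (('X - w%:P) ^+ 2 * U w + s%:P * N)^`()^`().[w] = 2 * H + s * N^`()^`().[w].
  have two : (2 : {poly R}).[w] = 2 by rewrite -polyC_natr hornerC.
  rewrite derivD d2 dN derivD d1 dN !(two, hornerXsubC, hornerD, hornerM, hornerC) subrr.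
  by rewrite /H; ring.
rewrite e0 e1 e2 -subr_ge0 => L.
have : s * (2 * (H * N.[w])) <= s * (s * (N^`().[w] ^+ 2 - N.[w] * N^`()^`().[w])).
  rewrite -subr_ge0; apply: le_trans L _.
  by rewrite le_eqVlt; apply/orP; left; apply/eqP; ring.
by rewrite ler_pM2l // leNgt sK.
Unshelve. all: by end_near. Qed.

Let near_node_free (u : 'I_m.+2 -> R) : (forall i, w != u i) ->
  \forall d \near (0 : R)^'+, forall i, d < `|u i - w|.
Proof.
move=> wu; apply: filter_forall => i; apply: nbhs_right_lt.
by rewrite normr_gt0 subr_eq0 eq_sym.
Qed.

(** By interlacing no a_i is a b_j, so one of the two families keeps a distance from w; on that
    family the quartic of the left side will be tested. *)
Let node_free : (forall i, w != a i) \/ (forall i, w != b i).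
Proof.
have [h|/existsNP[i /negP/negPn/eqP wi]] := pselect (forall i, w != a i); first by left.
right=> j; rewrite wi; case: hab => h1 h2.
have [->|/ltn_ord_case[ij|ij]] := eqVneq i j; first by rewrite lt_eqF.
- by rewrite lt_eqF // (lt_trans (interlaced_mono_a hab ij)).
- by rewrite gt_eqF // h2.
Qed.

(** Times H, the polynomial (X - w)^2 U - s N is negative at w and, for small s, positive at w - d
    and w + d, so it has roots r1 < w < r2 within d of w. A non-real pair would complete a quartic
    divisor that is nonnegative outside (r1, r2), in particular at every node of a family farther
    than d from w. *)
Lemma left_side_not_liquid :
  \forall s \near (0 : R)^'+, ~ liquid_region a b (ecurve a b w%:E - s *: (T.2, - T.1)).
Proof.
have [H0 _] := tangent_direction.
have HH : 0 < H * H by rewrite -expr2 exprn_even_gt0.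
have cU (v : R) : H * (U w).[w + v * d] @[d --> (0 : R)^'+] --> H * H.
  apply: cvgM; first exact: cvg_cst.
  apply: (@cvg_comp _ _ _ (fun d => w + v * d) (horner (U w)) _ (nbhs w)).
    2: exact: continuous_horner.
  have : w + v * d @[d --> (0 : R)^'+] --> w + v * 0.
    apply: cvgD; first exact: cvg_cst.
    by apply: cvgM; [exact: cvg_cst|exact: cvg_within].
  by rewrite mulr0 addr0.
(* d is fixed before s: it must isolate w from one node family and keep U of the sign of H at w - d
   and w + d. *)
have [d [d0 dU1 dU2 dfree]] : exists d, [/\ 0 < d, 0 < H * (U w).[w + 1 * d],
    0 < H * (U w).[w + (- 1) * d] &
    (forall i, d < `|a i - w|) \/ (forall i, d < `|b i - w|)].
  have f1 : \forall d \near (0 : R)^'+,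
      (forall i, d < `|a i - w|) \/ (forall i, d < `|b i - w|).
    case: node_free => /near_node_free; apply: filterS => d; by [left|right].
  have f2 : \forall d \near (0 : R)^'+, 0 < H * (U w).[w + 1 * d].
    by exact: (cvgr_gt _ (cU 1) _ HH).
  have f3 : \forall d \near (0 : R)^'+, 0 < H * (U w).[w + (- 1) * d].
    by exact: (cvgr_gt _ (cU (- 1)) _ HH).
  have f4 : \forall d \near (0 : R)^'+, 0 < d by exact: nbhs_right_gt.
  have [d [[d1 d2] [d3 d4]]] := filter_ex (filterI (filterI f1 f2) (filterI f3 f4)).
  by exists d.
pose P s := ('X - w%:P) ^+ 2 * U w + (- s)%:P * N.
have PE s : slope_poly a b (ecurve a b w%:E - s *: (T.2, - T.1)).1
    (ecurve a b w%:E - s *: (T.2, - T.1)).2 = P s.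
  by rewrite -scaleNr slope_poly_affine slopeE.
have Pnear x : x != w -> 0 < H * (U w).[x] -> \forall s \near (0 : R)^'+, 0 < H * (P s).[x].
  move=> xw Hx.
  have c : H * (P s).[x] @[s --> (0 : R)^'+] --> H * ((x - w) ^+ 2 * (U w).[x] + - 0 * N.[x]).
    have e s : H * (P s).[x] = H * ((x - w) ^+ 2 * (U w).[x] + - s * N.[x]).
      by rewrite /P hornerD !hornerM !hornerXsubC hornerC.
    under eq_cvg do rewrite e.
    apply: cvgM; first exact: cvg_cst.
    apply: cvgD; first exact: cvg_cst.
    by apply: cvgM; [apply: cvgN; exact: cvg_within|exact: cvg_cst].
  apply: (cvgr_gt _ c); rewrite oppr0 mul0r addr0 mulrCA mulr_gt0 //.
  by rewrite exprn_even_gt0 //= subr_eq0.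
near=> s.
have s0 : 0 < s by near: s; exact: nbhs_right_gt.
have Pr : 0 < H * (P s).[w + 1 * d].
  near: s; apply: Pnear => //.
  by rewrite mul1r -subr_eq0 addrAC subrr add0r gt_eqF.
have Pl : 0 < H * (P s).[w + (- 1) * d].
  near: s; apply: Pnear => //.
  by rewrite mulN1r -subr_eq0 addrAC subrr add0r oppr_eq0 gt_eqF.
have Pw : H * (P s).[w] < 0.
  rewrite /P hornerD !hornerM hornerXsubC hornerC subrr !mul0r add0r.
  by rewrite mulrCA mulNr oppr_lt0 mulr_gt0 // HN_gt0.
have rootE' (Q : {poly R}) x : Q = H *: P s \/ Q = - (H *: P s) -> root Q x -> (P s).[x] = 0.
  by move=> [|] ->; rewrite rootE ?hornerN ?oppr_eq0 hornerZ mulf_eq0 (negPf H0) /= => /eqP.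
have [r1 /andP[lr1 r1w] Pr1] : exists2 x, w + (- 1) * d <= x <= w & root (- (H *: P s)) x.
  apply: poly_ivt; first by rewrite mulN1r lerBlDr lerDl ltW.
  by rewrite !hornerN !hornerZ oppr_le0 oppr_ge0 !ltW.
have [r2 /andP[wr2 r2r] Pr2] : exists2 x, w <= x <= w + 1 * d & root (H *: P s) x.
  apply: poly_ivt; first by rewrite mul1r lerDl ltW.
  by rewrite !hornerZ !ltW.
have z1 := rootE' _ _ (or_intror erefl) Pr1; have z2 := rootE' _ _ (or_introl erefl) Pr2.
have r1w' : r1 < w.
  by rewrite lt_neqAle r1w andbT; apply: contraTneq Pw => <-; rewrite z1 mulr0 ltxx.
have wr2' : w < r2.
  by rewrite lt_neqAle wr2 andbT; apply: contraTneq Pw => ->; rewrite z2 mulr0 ltxx.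
move=> /(liquid_quadratic hab hsum)[x [y [y0]]]; rewrite PE => dQ.
pose Q := ('X - x%:P) ^+ 2 + (y ^+ 2)%:P.
have Q0 : Q != 0 by rewrite -size_poly_eq0 size_quad.
have Qr r : ~~ root Q r.
  by rewrite rootE /Q hornerD horner_exp hornerXsubC hornerC gt_eqF // sqdist_gt0 // gt_eqF.
apply: (@slope_poly_no_quartic _ _ a b hab (ecurve a b w%:E - s *: (T.2, - T.1)).1
   (ecurve a b w%:E - s *: (T.2, - T.1)).2 (('X - r1%:P) * (('X - r2%:P) * Q))).
- by rewrite !size_mul ?mulf_neq0 ?polyXsubC_eq0 // !size_XsubC size_quad.
- have pos t : d < `|t - w| -> 0 <= (('X - r1%:P) * (('X - r2%:P) * Q)).[t].
    move=> dt; rewrite !hornerM !hornerXsubC /Q hornerD horner_exp hornerXsubC hornerC mulrA.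
    apply: mulr_ge0; last by rewrite addr_ge0 ?sqr_ge0.
    have [tw|tw] := lerP 0 (t - w); last rewrite -mulrNN !opprB.
      by rewrite (ger0_norm tw) in dt; apply: mulr_ge0; lra.
    by rewrite (ltr0_norm tw) in dt; apply: mulr_ge0; lra.
  by case: dfree => h; [left|right] => i; apply: pos.
- rewrite PE Gauss_dvdp; last first.
    rewrite coprimep_sym coprimep_XsubC rootM negb_or Qr andbT root_XsubC.
    by rewrite lt_eqF // (lt_trans r1w').
  rewrite dvdp_XsubCl rootE z1 eqxx /= Gauss_dvdp; last first.
    by rewrite coprimep_sym coprimep_XsubC Qr.
  by rewrite dvdp_XsubCl rootE z2 eqxx dQ.
Unshelve. all: by end_near. Qed.

End AtPoint.

Lemma ecurve_right : lies_right_of (liquid_region a b) (ecurve a b).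
Proof.
move=> w T dT T0.
exact: filterI (right_side_liquid dT T0) (left_side_not_liquid dT T0).
Qed.

End RightSide.

Unset Implicit Arguments.

Theorem proposition2p6 (R : realType) (m : nat) (a b : 'I_m.+2 -> R)
    (hab : interlacing a b) (hsum : \sum_i (b i - a i) = 1) :
  [/\ (* continuous closed curve, simply covering the frozen boundary *)
      continuous (frozen_curve a b),
      frozen_curve a b +oo%E = frozen_curve a b -oo%E,
      set_bij [set x : \bar R | (x < +oo)%E] (frontier (liquid_region a b))
        (frozen_curve a b),
      (* the parameter is the double real solution *)
      forall w : R, (('X - w%:P) ^+ 2 %|
        slope_poly a b (frozen_curve a b w%:E).1 (frozen_curve a b w%:E).2)%R &
      (* orientation *)
      (forall p, liquid_region a b p ->
        winds_once_clockwise (frozen_curve a b) p) /\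
      lies_right_of (liquid_region a b) (frozen_curve a b)].
Proof.
rewrite (frozen_curveE hab hsum); split.
- exact: ecurve_continuous.
- by have [-> ->] := ecurve_infty a b.
- exact: ecurve_bij.
- by move=> w; rewrite ecurve_fin (slope_poly_fin hab hsum) dvdp_mulr.
- by split; [move=> p; exact: ecurve_winding|exact: ecurve_right].
Qed.
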